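(* Let $n \geqslant 1$, let $\lambda$ be an integer partition with $\lambda_1+\ell(\lambda)-1=n$, and let $c \in \mathfrak{S}_{n+1}$ be a Coxeter element. Then the map $\mathcal{RSK}_{\lambda,c}$ is a bijection from the set of fillings of shape $\lambda$ (functions $\mathrm{Fer}(\lambda)\to\mathbb{N}$) onto the set $\mathrm{RPP}(\lambda)$ of reverse plane partitions of shape $\lambda$.
   Context: Integer partitions $\lambda=(\lambda_1\geqslant\dots\geqslant\lambda_p>0)$, $\ell(\lambda)=p$; Ferrers diagram $\mathrm{Fer}(\lambda)=\{(i,j)\in(\mathbb{N}^* )^2: j\leqslant\lambda_i\}$ (matrix coordinates). A filling of shape $\lambda$ is a map $f:\mathrm{Fer}(\lambda)\to\mathbb{N}$; it is a reverse plane partition if it is weakly increasing for the componentwise order on $\mathrm{Fer}(\lambda)$. Diagonals: for $k\in\{1,\dots,n\}$, $D_k(\lambda)=\{(i,j)\in\mathrm{Fer}(\lambda):\lambda_1+i-j=k\}$ and $\delta_k=\max\{\min(i,j):(i,j)\in D_k(\lambda)\}$ ($=\#D_k(\lambda)$). The $\lambda$-diagonal coordinates of $(i,j)\in D_k(\lambda)$ are $\langle k,\delta\rangle_\lambda$ with $\delta=\delta_k-\min(i,j)+1\in\{1,\dots,\delta_k\}$. Row/column labels: label the unit segments of the south-east boundary of $\mathrm{Fer}(\lambda)$ by $1,\dots,n+1$ going from top-right to bottom-left; each row and each column gets the label of its boundary segment. Let $\mathbf L=\{\ell_1<\dots<\ell_p\}$ be the set of row labels (row $i$ labelled $\ell_i$)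 and $\mathbf R=\{r_1<\dots<r_q\}$ the set of column labels (column $j$ labelled $r_{q-j+1}$); then $1\in \mathbf L$, $n+1\in\mathbf R$, $\mathbf L\sqcup\mathbf R=\{1,\dots,n+1\}$, and $(i,j)\in\mathrm{Fer}(\lambda)$ iff $\ell_i<r_{q-j+1}$. Write $[\ell,r]$ for the box in row labelled $\ell$ and column labelled $r$. Coxeter elements: $s_i=(i,i+1)$; $c\in\mathfrak{S}_{n+1}$ is a Coxeter element if it is a product of $s_1,\dots,s_n$ in some order, each appearing exactly once. Auslander–Reiten quiver $\mathrm{AR}(c)$: directed graph with vertices the transpositions $(i,j)$, $1\le i<j\le n+1$, and arrows $(i,j)\to(i,c(j))$ whenever $i<c(j)$, and $(i,j)\to(c(i),j)$ whenever $c(i)<j$; it is acyclic. For $k\in\{1,\dots,n\}$, $\mathrm{AR}^{[k]}(c)$ is its full subgraph on vertices $(\ell,r)$ with $\ell\leqslant k<r$. Greene–Kleitman invariant: for an acyclic directed graph $G$ and $g:G_0\to\mathbb{N}$, a path is a sequence of vertices $(v_0,\dots,v_m)$, $m\ge0$, with consecutive vertices joined by arrows; for $t\ge1$ let $M_t$ be the maximum over $t$-tuples of paths of $\sum_{v}g(v)$, the sum over the union of the vertex sets of the paths, and $M_0=0$; $\mathrm{GK}_G(g)=(M_t-M_{t-1})_{t\geqslant1}$, an integer partition. Definition of $\mathcal{RSK}_{\lambda,c}$: for a filling $f$ of $\lambda$, let $\mathrm{rep}_{\lambda,c}(f)$ be the filling of $\mathrm{AR}(c)$ with $\mathrm{rep}_{\lambda,c}(f)(\ell,r)=f([\ell,r])$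 if $\ell\in\mathbf L$, $r\in\mathbf R$, $\ell<r$, and $0$ otherwise. Then $\mathcal{RSK}_{\lambda,c}(f)$ is the filling of $\lambda$ with $\mathcal{RSK}_{\lambda,c}(f)(\langle k,\delta\rangle_\lambda)$ equal to the $\delta$-th part of $\mathrm{GK}_{\mathrm{AR}^{[k]}(c)}$ applied to the restriction of $\mathrm{rep}_{\lambda,c}(f)$ to $\mathrm{AR}^{[k]}(c)$. *)

(* Defs.v *)
From HB Require Import structures.
From mathcomp Require Import all_boot all_order all_fingroup.
From mathcomp Require Import boolp.

Set Implicit Arguments.
Unset Strict Implicit.
Unset Printing Implicit Defensive.

Definition is_partition (la : seq nat) : bool :=
  sorted geq la && all (fun m => 0 < m) la.

(* Boxes of Fer(la), 0-based: the box (a,b) is the paper's (a+1, b+1). *)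
Definition cell (la : seq nat) : Type :=
  {x : 'I_(size la) * 'I_(head 0 la) | x.2 < nth 0 la x.1}.
HB.instance Definition _ (la : seq nat) := Finite.copy (cell la)
  {x : 'I_(size la) * 'I_(head 0 la) | x.2 < nth 0 la x.1}.

Definition crow (la : seq nat) (x : cell la) : nat := (val x).1.
Definition ccol (la : seq nat) (x : cell la) : nat := (val x).2.

Definition is_rpp (la : seq nat) (f : {ffun cell la -> nat}) : Prop :=
  forall x y : cell la, crow x <= crow y -> ccol x <= ccol y -> f x <= f y.

Definition diag (la : seq nat) (x : cell la) : nat := head 0 la + crow x - ccol x.
(* min(i,j) in 1-based coordinates *)
Definition minij (la : seq nat) (x : cell la) : nat := minn (crow x).+1 (ccol x).+1.
Definition delta_k (la : seq nat) (k : nat) : nat :=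
  \max_(y : cell la | diag y == k) minij y.
Definition dcoord (la : seq nat) (x : cell la) : nat :=
  delta_k la (diag x) - minij x + 1.

(* Row i (1-based) gets label i + lambda_1 - lambda_i ; column j (1-based) gets
   label lambda'_j + lambda_1 - j + 1.  Here 0-based indices. *)
Definition rowlab (la : seq nat) (a : nat) : nat := a.+1 + head 0 la - nth 0 la a.
Definition collab (la : seq nat) (b : nat) : nat :=
  count (fun m => b < m) la + head 0 la - b.

(* ---------- Coxeter elements of S_{n+1} (labels 1..n+1 <-> 'I_(n.+1)) ---------- *)
Definition simple_tr (n i : nat) : 'S_(n.+1) := tperm (inord i.-1) (inord i).

Definition coxeter (n : nat) (c : 'S_(n.+1)) : Prop :=
  exists s : seq nat, perm_eq s (iota 1 n) /\ c = (\prod_(i <- s) simple_tr n i)%g.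

Definition clab (n : nat) (c : 'S_(n.+1)) (x : nat) : nat :=
  if (0 < x) && (x <= n.+1) then (c (inord x.-1) : nat).+1 else x.

Definition ARvert (n : nat) := ('I_(n.+2) * 'I_(n.+2))%type.

Definition AR_all (n : nat) : {set ARvert n} :=
  [set v : ARvert n | (0 < v.1) && (v.1 < v.2)].

Definition AR_arrow (n : nat) (c : 'S_(n.+1)) : rel (ARvert n) :=
  fun v w =>
    [&& (w.1 : nat) == v.1, (w.2 : nat) == clab c v.2 & v.1 < clab c v.2]
    || [&& (w.2 : nat) == v.2, (w.1 : nat) == clab c v.1 & clab c v.1 < v.2].

Definition AR_k (n k : nat) : {set ARvert n} :=
  [set v in AR_all n | (v.1 <= k) && (k < v.2)].

Definition is_gpath (V : finType) (e : rel V) (A : {set V}) (p : seq V) : bool :=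
  if p is x :: q then path e x q && all (fun v => v \in A) p else false.

Definition GK_M (V : finType) (e : rel V) (A : {set V}) (g : V -> nat) (t : nat) : nat :=
  \max_(S : {set V} | `[< exists ps : seq (seq V),
          [/\ size ps = t, all (is_gpath e A) ps & S = \bigcup_(p <- ps) [set x in p]] >])
     \sum_(v in S) g v.

(* the d-th part (d >= 1) of GK_G(g) *)
Definition GK_part (V : finType) (e : rel V) (A : {set V}) (g : V -> nat) (d : nat) : nat :=
  GK_M e A g d - GK_M e A g d.-1.

Definition rep (la : seq nat) (n : nat) (f : {ffun cell la -> nat}) (v : ARvert n) : nat :=
  match [pick x : cell la | (rowlab la (crow x) == v.1) && (collab la (ccol x) == v.2)] with
  | Some x => f x
  | None => 0
  end.

Definition RSK (n : nat) (c : 'S_(n.+1)) (la : seq nat) (f : {ffun cell la -> nat})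
  : {ffun cell la -> nat} :=
  [ffun x => GK_part (AR_arrow c) (AR_k n (diag x)) (@rep la n f) (dcoord x)].

(* Main.v *)
Require Import Defs.
From HB Require Import structures.
From mathcomp Require Import all_boot all_order all_fingroup zify.
From mathcomp Require Import boolp.

Set Implicit Arguments.
Unset Strict Implicit.
Unset Printing Implicit Defensive.

(** An inequality follows once the union of two optimal families, counted with multiplicity, splits
    into families of the sizes wanted. The obstacle is the boundary, since some families may not use
    the new row or the new column. When one of the target families is unrestricted, alternation
    works: every boundary box that is met is met by an extreme path of even index, so the even paths
    take the boundary. In the converse direction row and column may have to go to different families
    although their extreme paths have the same parity, or are one path. Colours must then change
    along a path, which is allowed only where two paths meet. Neighbouring sorted paths have
    opposite parities, so the strands are oriented, and a strand that starts at the end of path 0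
    cannot reach the forbidden ends. The sizes are controlled by pairing starting points, as each
    pair gives one path to each family. A whole diagonal of the image is read at one lattice point,
    where the diagonal leaves the diagram. A new corner box moves this point by one diagonal step
    and leaves the other diagonals alone, so each box costs exactly one local rule. *)

(* Labels at most [k] form an arc of the cycle [c], and so do the others, hence
   AR^[k](c) is a grid and its Greene-Kleitman invariant is that of the matrix of
   boxes [l, r] with l <= k < r, rows and columns taken in arc order.  Passing
   from [k] to [k+1] adds a first or last row, or deletes a first or last column.
   So on lattice points (r, s), the invariants of the first r rows and s columns
   form a growth diagram with two kinds of corners: the new row and the new
   column meet at an end of every long path, or at the other two corners.  With
   N, A, B, U the partial sums of the invariants with both, only the new row,
   only the new column and neither, and m the corner entry, the local rules are
     N_t + U_(t-1) = m + max (A_t + B_(t-1), A_(t-1) + B_t)   and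
     N_t + U_t = max (A_t + B_t, N_(t+1) + U_(t-1)).
   Both come from sorting the union of two path families pointwise and
   redistributing it: alternately for one inequality, and along the strands of
   the crossing pattern (as for Temperley-Lieb diagrams) for the other.  Each
   rule is, A and B being fixed, a bijection between the pairs (U, m) and the
   N, compatible with interlacing; the theorem follows by adding the boxes of
   the diagram one at a time. *)

(** * Families of lattice paths *)

Lemma count_iota_sum (n : nat) (P : pred nat) :
  count P (iota 0 n) = \sum_(i < n) P i.
Proof.
rewrite -val_enum_ord count_map -sum1_count big_mkcond big_enum /=.
by apply: eq_bigr => i _; case: (P i).
Qed.

Lemma sorted_nth_leq (s : seq nat) (i c : nat) :
  sorted leq s -> i < size s ->
  (nth 0 s i <= c) = (i < count (fun x => x <= c) s).
Proof.
elim: s i => [|x s IH] [|i] //= xs; rewrite ?ltnS => lti;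
  case: (leqP x c) => [lexc|ltcx]; rewrite ?add1n ?ltnS ?IH ?(path_sorted xs) //;
suff -> : count (fun y => y <= c) s = 0 by [];
apply/eqP; rewrite eqn0Ngt -has_count; apply/hasPn => y ys; rewrite -ltnNge;
apply: leq_trans ltcx _;
by have /allP := order_path_min leq_trans xs; apply.
Qed.

(** The [i]-th smallest value is at most [c] exactly when more than [i] values are, and passing from
    [Q] to the smaller [P] can only increase that count. *)
Lemma order_stat_mono (n : nat) (P Q : nat -> nat) (i : nat) :
  (forall j, j < n -> P j <= Q j) -> i < n ->
  nth 0 (sort leq (mkseq P n)) i <= nth 0 (sort leq (mkseq Q n)) i.
Proof.
move=> PQ lti.
have srt f : sorted leq (sort leq (mkseq f n)) by apply: sort_sorted => x y; apply: leq_total.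
have sz f : size (sort leq (mkseq f n)) = n by rewrite size_sort size_mkseq.
rewrite sorted_nth_leq ?sz //.
have := leqnn (nth 0 (sort leq (mkseq Q n)) i); rewrite {1}sorted_nth_leq ?sz //.
set c := nth _ _ _ => h; apply: leq_trans h _.
rewrite !count_sort !count_map !count_iota_sum; apply: leq_sum => j _ /=.
by case: (leqP (Q j) c) => //= h; rewrite (leq_trans (PQ _ _) h).
Qed.

Lemma order_stat_succ (n : nat) (P : nat -> nat) (i : nat) : i < n ->
  nth 0 (sort leq (mkseq (fun j => (P j).+1) n)) i
    = (nth 0 (sort leq (mkseq P n)) i).+1.
Proof.
move=> lti; rewrite /mkseq map_comp sort_map -(nth_map 0 0) ?size_sort ?size_map ?size_iota //.
Qed.

(* A monotone lattice path from (0,0) to (a,b), parametrised by the level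
   s = row + column; [x s] is its column at level [s]. *)
Definition gpath (a b : nat) (x : nat -> nat) : Prop :=
  [/\ x 0 = 0, x (a + b) = b & forall s, s < a + b -> x s <= x s.+1 <= (x s).+1].

Lemma gpath_lip (a b : nat) (x : nat -> nat) (s s' : nat) :
  gpath a b x -> s <= s' -> s' <= a + b -> x s <= x s' <= x s + (s' - s).
Proof.
move=> [_ _ st] le; rewrite -(subnKC le); move: (s' - s) => k; rewrite addKn.
elim: k => [|k IH] lek; first by rewrite !addn0 leqnn.
have /IH : s + k <= a + b by lia.
have := st (s + k); rewrite -addnS; lia.
Qed.

Lemma gpath_bounds (a b : nat) (x : nat -> nat) (s : nat) :
  gpath a b x -> s <= a + b -> [/\ x s <= b, x s <= s & s <= x s + a].
Proof.
move=> gx les; have [x0 xT _] := gx.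
have := gpath_lip gx les (leqnn _); have := gpath_lip gx (leq0n s) les.
by rewrite x0 xT; split; lia.
Qed.

(** [u] is a row and [v] a column, so the cell sits at level [u + v]. *)
Definition cov (t : nat) (X : nat -> nat -> nat) (u v : nat) : bool :=
  has (fun i => X i (u + v) == v) (iota 0 t).

Lemma covP (t : nat) (X : nat -> nat -> nat) (u v : nat) :
  reflect (exists2 i, i < t & X i (u + v) = v) (cov t X u v).
Proof.
apply: (iffP hasP) => [[i]|[i lti e]].
  by rewrite mem_iota => /andP[_ lti] /eqP; exists i.
by exists i; [rewrite mem_iota | apply/eqP].
Qed.

(** Order statistics are monotone and commute with the successor, so the condition that a step
    raises the column by 0 or 1 survives sorting each level on its own. *)
Lemma sort_family (a b n : nat) (P : nat -> nat -> nat) :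
  (forall i, i < n -> gpath a b (P i)) ->
  exists Y : nat -> nat -> nat,
  [/\ forall i, i < n -> gpath a b (Y i),
      forall i j s, i <= j -> j < n -> Y i s <= Y j s
    & forall s v, \sum_(i < n) (P i s == v) = \sum_(i < n) (Y i s == v)].
Proof.
move=> gP; pose L s := sort leq (mkseq (P^~ s) n).
have srt s : sorted leq (L s) by apply: sort_sorted => x y; apply: leq_total.
have sz s : size (L s) = n by rewrite size_sort size_mkseq.
have cst s k i : (forall j, j < n -> P j s = k) -> i < n -> nth 0 (L s) i = k.
  move=> Pk lti; have : nth 0 (L s) i \in L s by rewrite mem_nth ?sz.
  by rewrite mem_sort => /mapP[j]; rewrite mem_iota => /andP[_ ltj] ->; apply: Pk.
exists (fun i s => nth 0 (L s) i); split=> [i lti|i j s le ltj|s v].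
- split=> [||s lts].
  + by apply: cst => // j /gP[].
  + by apply: cst => // j /gP[].
  + rewrite -(order_stat_succ (P^~ s) lti); apply/andP.
    by split; apply: order_stat_mono => // j /gP[_ _ /(_ s lts)/andP[]].
- by apply: (sorted_leq_nth leq_trans leqnn) => //; rewrite inE sz ?(leq_ltn_trans le).
- rewrite -(count_iota_sum n (fun i => P i s == v)) -(count_iota_sum n (fun i => nth 0 (L s) i == v)).
  transitivity (count (pred1 v) (L s)); first by rewrite count_sort count_map.
  by rewrite -[L s in LHS](mkseq_nth 0) sz count_map.
Qed.

(* The nodes [(s, i)] are the segments of the [i]-th sorted path just before
   level [s]; [H s] pairs up some of the paths meeting at the top of node level
   [s].  Walking up along even paths, down along odd ones, and switching path
   at each pairing is an injective partial map: since pairings change the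
   parity, the orientation is consistent.  [sigma] is the indicator of the
   orbit that starts at the bottom node of path 0. *)
Lemma strand (S : nat) (H : nat -> nat -> nat) :
  (forall s i, H s (H s i) = i) ->
  (forall s i, H s i != i -> odd (H s i) = ~~ odd i) ->
  exists sigma : nat -> nat -> bool,
  [/\ [/\ forall s i, s <= S -> sigma s (H s i) = sigma s i,
      forall s i, s < S -> sigma s (H s.+1 i) = sigma s i
    & forall s i, s < S -> H s.+1 i = i -> sigma s.+1 i = sigma s i],
      sigma S 0,
      forall j, ~~ odd j -> j != 0 -> sigma S j = false
    & forall j, odd j -> H 0 j = j -> sigma 0 j = false].
Proof.
move=> Hinv Hpar.
pose up (p : nat * nat) := if H p.1 p.2 != p.2 then Some (p.1, H p.1 p.2)
  else if p.1 is s.+1 then Some (s, p.2) else None.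
pose dn (p : nat * nat) := if p.1 < S then
  if H p.1.+1 p.2 != p.2 then Some (p.1, H p.1.+1 p.2) else Some (p.1.+1, p.2)
  else None.
pose next p := if odd p.2 then dn p else up p.
pose prev p := if odd p.2 then up p else dn p.
(* A pairing changes the parity, so a walk that switches path also reverses direction; hence [prev]
   undoes [next]. *)
have nextK p z : p.1 <= S -> next p = Some z -> prev z = Some p /\ z.1 <= S.
  case: p => s i /= les; rewrite /next /prev /=; case: ifP => oi.
    rewrite /dn /=; case: ltnP => // lts; case: ifPn => [ne|/negPn/eqP e] [<-] /=.
      by rewrite Hpar // oi /= lts Hinv eq_sym ne.
    by rewrite oi /up /= e eqxx.
  rewrite /up /=; case: ifPn => [ne [<-]|/negPn/eqP e] /=.
    by rewrite Hpar // oi /= Hinv eq_sym ne.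
  by case: s les e => // s les e [<-] /=; rewrite oi /dn /= les e eqxx ltnW.
pose C p := exists k, iter k (obind next) (Some (S, 0)) = Some p.
have C1 p : C p -> p.1 <= S.
  case=> k; elim: k p => [|k IH] p /=; first by case=> <-.
  case E: (iter _ _ _) => [z|//] /= nz.
  by have [] := nextK z p (IH z E) nz.
(* Even nodes at level [S] and unpaired odd nodes at level 0 have no predecessor, so the orbit
   avoids all of them except its start. *)
have src p : C p -> prev p = None -> p = (S, 0).
  case=> -[/=[<-]//|k /=]; case E: (iter _ _ _) => [z|//] /= nz.
  have [|-> //] := nextK z p _ nz; by apply: C1; exists k.
have CE p z : p.1 <= S -> next p = Some z -> C p <-> C z.
  move=> leS nz; split=> [[k e]|[[|k] /=]].
  - by exists k.+1; rewrite /= e.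
  - move=> [e]; subst z; have [] := nextK _ _ leS nz.
    by rewrite /prev /= /dn /= ltnn.
  - case E: (iter _ _ _) => [z'|//] /= nz'; exists k; rewrite E.
    have [e1 _] := nextK _ _ leS nz; have [|e2 _] := nextK z' z _ nz'.
      by apply: C1; exists k.
    by move: e2; rewrite e1.
exists (fun s i => `[< C (s, i) >]); split.
- split=> [s i les|s i lts|s i lts e].
  + have [->//|ne] := eqVneq (H s i) i; apply: asbool_equiv_eq.
    case oi: (odd i); last by apply: iff_sym; apply: CE; rewrite // /next /= oi /up /= ne.
    by apply: CE; rewrite // /next /= Hpar // oi /= /up /= Hinv eq_sym ne.
  + have [->//|ne] := eqVneq (H s.+1 i) i; apply: asbool_equiv_eq.
    case oi: (odd i); first by apply: iff_sym; apply: CE; rewrite /= ?(ltnW lts) // /next /= oi /dn /= lts ne.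
    by apply: CE; rewrite /= ?(ltnW lts) // /next /= Hpar // oi /= /dn /= lts Hinv eq_sym ne.
  + apply: asbool_equiv_eq; case oi: (odd i).
      by apply: iff_sym; apply: CE; rewrite /= ?(ltnW lts) // /next /= oi /dn /= lts e eqxx.
    by apply: CE; rewrite /= ?lts // /next /= oi /up /= e eqxx.
- by apply/asboolP; exists 0.
- move=> j oj j0; apply/asboolP => /src; rewrite /prev /= (negbTE oj) /dn /= ltnn.
  by move=> /(_ erefl)[e]; rewrite e in j0.
- move=> j oj e; apply/asboolP => /src; rewrite /prev /= oj /up /= e eqxx.
  by move=> /(_ erefl)[_ e0]; rewrite e0 in oj.
Qed.

(** [chi s i] colours the segment of path [i] just before level [s]. By the balance condition each
    cell is left by as many coloured segments as enter it, so the [j]-th coloured segments of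
    successive levels fit together into a path. *)
Lemma extract_family (a b n : nat) (Y : nat -> nat -> nat) (chi : nat -> nat -> bool) :
  (forall i, i < n -> gpath a b (Y i)) ->
  (forall i j s, i <= j -> j < n -> Y i s <= Y j s) ->
  (forall s v, s <= a + b ->
    \sum_(i < n) ((Y i s == v) && chi s i) = \sum_(i < n) ((Y i s == v) && chi s.+1 i)) ->
  exists X : nat -> nat -> nat,
    (forall j, j < \sum_(i < n) chi 0 i -> gpath a b (X j)) /\
    (forall s i, s <= a + b -> i < n -> chi s i ->
       exists2 j, j < \sum_(i < n) chi 0 i & X j s = Y i s).
Proof.
move=> gY sY bal.
pose I s := [seq i <- iota 0 n | chi s i].
pose L s s' := [seq Y i s | i <- I s'].
have Isz s : size (I s) = \sum_(i < n) chi s i by rewrite size_filter count_iota_sum.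
have In s i : i \in I s = (i < n) && chi s i by rewrite mem_filter mem_iota andbC.
have srt s s' : sorted leq (L s s').
  apply: (@homo_sorted_in _ _ (fun i => i < n) (Y^~ s) leq leq) => [i j _ ltj le||].
  - exact: sY.
  - by apply/allP => i; rewrite In => /andP[].
  - by apply: sorted_filter; [exact: leq_trans|exact: iota_sorted].
have LE s : s <= a + b -> L s s = L s s.+1.
  move=> les; apply: (sorted_eq leq_trans anti_leq) => //; apply/allP => v _ /=.
  rewrite !count_map !count_filter !count_iota_sum; apply/eqP.
  by have := bal s v les.
have sz s : s <= (a + b).+1 -> size (I s) = \sum_(i < n) chi 0 i.
  elim: s => [|s IH] les; first by rewrite Isz.
  by rewrite -IH 1?ltnW // -(size_map (Y^~ s)) -[map _ _]/(L s s.+1) -LE // size_map.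
exists (fun j s => nth 0 (L s s) j); split=> [j ltj|s i les lti ci]; last first.
  have iI : i \in I s by rewrite In lti.
  exists (index i (I s)); first by rewrite -(sz s) ?index_mem // ltnW.
  by rewrite (nth_map 0) ?index_mem // nth_index.
have nI s : s <= (a + b).+1 -> nth 0 (I s) j < n.
  by move=> les; have := mem_nth 0 (_ : j < size (I s)); rewrite sz // In => /(_ ltj)/andP[].
have LY s s' : s' <= (a + b).+1 -> nth 0 (L s s') j = Y (nth 0 (I s') j) s.
  by move=> les; rewrite (nth_map 0) // sz.
split=> [||s lts].
- by rewrite LY //; have [] := gY _ (nI 0 isT).
- by rewrite LY ?leqnSn //; have [] := gY _ (nI (a + b) (leqnSn _)).
- rewrite LE ?(ltnW lts) // !LY ?(leqW lts) //.
  by have [_ _ /(_ s lts)] := gY _ (nI s.+1 (leqW lts)).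
Qed.

(* Pairing the first two paths of a run suffices: the only purpose is to have
   both colours on every cell visited at least twice. *)
Definition partner (n : nat) (y : nat -> nat) (i : nat) : nat :=
  if [&& i.+1 < n, y i.+1 == y i & (i == 0) || (y i.-1 != y i)] then i.+1
  else if [&& 0 < i, i < n, y i.-1 == y i & (i.-1 == 0) || (y i.-2 != y i)] then i.-1
  else i.

Lemma partnerP (n : nat) (y : nat -> nat) (i : nat) :
  [/\ partner n y (partner n y i) = i, y (partner n y i) = y i,
      partner n y i != i -> odd (partner n y i) = ~~ odd i
    & i < n -> partner n y i < n].
Proof.
have [j ej] : exists j, partner n y i = j by exists (partner n y i).
rewrite !ej; move: ej; rewrite {1}/partner.
case: ifP => [/and3P[lti /eqP e h]|F] => [<-|].
  by split=> //; rewrite /partner /= ?e ?eqxx ?andbF ?lti /= ?h ?eqxx.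
case: ifP => [/and4P[i0 lti /eqP e h]|G] => <-.
  case: i i0 lti e h F => //= i _ lti e h F; split=> [|//||_]; last exact: ltnW.
    by rewrite /partner lti e eqxx /= h.
  by rewrite negbK.
by split; rewrite ?eqxx //= /partner F G.
Qed.

Lemma invol_bool_sum (n : nat) (h : nat -> nat) (f g : nat -> bool) :
  (forall i, h (h i) = i) -> (forall i, i < n -> h i < n) ->
  (forall i, i < n -> f i + f (h i) = g i + g (h i)) ->
  \sum_(i < n) f i = \sum_(i < n) g i.
Proof.
move=> hK hn fg.
pose k (i : 'I_n) := Ordinal (hn i (ltn_ord i)).
have kinj : injective k by apply: can_inj (k) _ => i; apply: val_inj; rewrite /= hK.
have sumk (e : nat -> bool) : \sum_(i < n) e i = \sum_(i < n) e (h i).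
  by rewrite (reindex_inj kinj).
have : \sum_(i < n) (f i + f (h i)) = \sum_(i < n) (g i + g (h i)).
  by apply: eq_bigr => i _; apply: fg.
by rewrite !big_split /= -(sumk f) -(sumk g) !addnn => /double_inj.
Qed.

(* The colour is [sigma] of [strand] shifted by the parity of the path, so that
   paired paths have opposite colours and swapping them at a crossing is free. *)
Lemma coloring (a b n : nat) (Y : nat -> nat -> nat) (core : nat -> nat -> bool)
    (h0 : nat -> nat) :
  (forall i j s, i <= j -> j < n -> Y i s <= Y j s) ->
  (forall i, h0 (h0 i) = i) -> (forall i, h0 i != i -> odd (h0 i) = ~~ odd i) ->
  exists chi : nat -> nat -> bool,
  [/\ forall s v, s <= a + b ->
        \sum_(i < n) ((Y i s == v) && chi s i) = \sum_(i < n) ((Y i s == v) && chi s.+1 i),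
      forall s v, s <= a + b ->
        \sum_(i < n) ((Y i s == v) && ~~ chi s i) = \sum_(i < n) ((Y i s == v) && ~~ chi s.+1 i),
      forall s i j c, s <= a + b -> i < j -> j < n -> Y i s = Y j s -> core s (Y i s) ->
        exists i', [/\ i' < n, chi s i' = c & Y i' s = Y i s],
      forall s i, s <= a + b -> ~~ core s (Y i s) -> chi s.+1 i = chi s i
    & [/\ chi (a + b).+1 0, forall j, ~~ odd j -> j != 0 -> ~~ chi (a + b).+1 j,
      forall j, odd j -> h0 j = j -> chi 0 j & forall i, h0 i != i -> chi 0 (h0 i) = ~~ chi 0 i]].
Proof.
move=> sY h0K h0par.
(* The crossings of level [s] are [H s.+1], and only core cells have any; index 0 is kept for the
   prescribed pairing of the starts. *)
pose H s i := if s is s'.+1 then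
  if core s' (Y i s') then partner n (Y^~ s') i else i else h0 i.
have HY s i : Y (H s.+1 i) s = Y i s.
  by rewrite /H; case: ifP => // _; have [_ ->] := partnerP n (Y^~ s) i.
have Hinv s i : H s (H s i) = i.
  case: s => [|s]; first exact: h0K.
  rewrite {1}/H HY; case: ifP => [c|c]; rewrite /H c //.
  by have [-> _ _ _] := partnerP n (Y^~ s) i.
have Hpar s i : H s i != i -> odd (H s i) = ~~ odd i.
  case: s => [|s]; first exact: h0par.
  rewrite /H; case: ifP => [c|c]; rewrite ?eqxx //.
  by have [_ _ h _] := partnerP n (Y^~ s) i.
have Hn s i : i < n -> H s.+1 i < n.
  by rewrite /H; case: ifP => // _ lti; have [_ _ _ h] := partnerP n (Y^~ s) i; apply: h.
have [sg [[s1 s2 s3] s4 s5 s6]] := @strand (a + b).+1 H Hinv Hpar.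
pose chi s i := sg s i (+) odd i.
have cu s i : s <= a + b -> H s.+1 i = i -> chi s.+1 i = chi s i.
  by move=> les e; rewrite /chi s3.
have cp s i : s <= (a + b).+1 -> H s i != i -> chi s (H s i) = ~~ chi s i.
  by move=> les e; rewrite /chi s1 // Hpar // addbN.
have cp' s i : s <= a + b -> H s.+1 i != i -> chi s (H s.+1 i) = ~~ chi s i.
  by move=> les e; rewrite /chi s2 // Hpar // addbN.
have bal (c : bool) s v : s <= a + b ->
    \sum_(i < n) ((Y i s == v) && (chi s i == c)) = \sum_(i < n) ((Y i s == v) && (chi s.+1 i == c)).
  move=> les; apply: (@invol_bool_sum n (H s.+1)
    (fun i => (Y i s == v) && (chi s i == c)) (fun i => (Y i s == v) && (chi s.+1 i == c))) => // i lti.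
    exact: Hn.
  rewrite HY; case: (Y i s == v); rewrite ?andFb // !andTb; have [e|ne] := eqVneq (H s.+1 i) i.
    by rewrite e cu.
  by rewrite cp // cp' //; case: (chi s i) (chi s.+1 i) c => [] [] [].
exists chi; split.
- move=> s v les; have := bal true s v les.
  by under eq_bigr do rewrite eqb_id; under [RHS]eq_bigr do rewrite eqb_id.
- move=> s v les; have := bal false s v les.
  by under eq_bigr do rewrite eqbF_neg; under [RHS]eq_bigr do rewrite eqbF_neg.
- move=> s i j c les ltij ltj e co.
  (* The first path through the cell is the one that [partner] joins to its successor. The two have
     opposite colours, so one of them has colour [c]. *)
  have ex : exists i, (i < n) && (Y i s == Y j s) by exists j; rewrite ltj eqxx.
  pose i0 := ex_minn ex.
  have [i0n /eqP ei0 mini] : [/\ i0 < n, Y i0 s == Y j s & forall k, k < n -> Y k s = Y j s -> i0 <= k].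
    rewrite /i0; case: ex_minnP => k /andP[kn ke] mk; split=> // l ln le.
    by apply: mk; rewrite ln le eqxx.
  have lei : i0 <= i by apply: mini => //; exact: ltn_trans ltj.
  have e1 : Y i0.+1 s = Y j s.
    apply/eqP; rewrite eqn_leq sY ?(leq_ltn_trans lei) //=.
    by rewrite -{1}ei0 sY // (leq_ltn_trans _ ltj) // (leq_ltn_trans lei).
  have lt1 : i0.+1 < n by apply: leq_ltn_trans ltj; exact: leq_ltn_trans ltij.
  have Hi0 : H s.+1 i0 = i0.+1.
    rewrite /H ei0 -e co /partner /= lt1 e1 ei0 eqxx /=.
    case: eqP => //= /eqP; rewrite -lt0n => i0pos; case: eqP => // e2.
    have := mini i0.-1 (leq_ltn_trans (leq_pred _) i0n) e2.
    by rewrite leqNgt prednK // leqnn.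
  have [/eqP ce|ce] := boolP (chi s i0 == c); first by exists i0; split; rewrite ?e.
  exists i0.+1; split; rewrite ?e1 ?e //.
  have := @cp' s i0 les; rewrite Hi0 -[X in _ != X]addn0 -[i0.+1]addn1 eqn_add2l => ->//.
  by move: ce; case: (chi s i0) c => [] [].
- by move=> s i les nc; apply: cu => //; rewrite /H (negbTE nc).
split.
- by rewrite /chi s4.
- by move=> j oj j0; rewrite /chi s5 // (negbTE oj).
- by move=> j oj e; rewrite /chi s6 // oj.
- by move=> i ne; apply: (@cp 0).
Qed.

(** * Exchange inequalities *)

Lemma bool_sum_gt0 (n : nat) (P : nat -> bool) :
  0 < \sum_(i < n) P i -> exists2 i, i < n & P i.
Proof.
rewrite -count_iota_sum -has_count => /hasP[i]; rewrite mem_iota => /andP[_ lti] Pi.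
by exists i.
Qed.

Lemma bool_sum_gt1 (n : nat) (P : nat -> bool) :
  1 < \sum_(i < n) P i -> exists i j, [/\ i < j, j < n, P i & P j].
Proof.
elim: n => [|n IH]; first by rewrite big_ord0.
rewrite big_ord_recr /=; case Pn: (P n) => /=.
  by rewrite addn1 ltnS => /bool_sum_gt0[i lti Pi]; exists i, n; split.
by rewrite addn0 => /IH[i [j [lij ljn Pi Pj]]]; exists i, j; split; rewrite // ltnW.
Qed.

Lemma bool_sum_ge1 (n : nat) (P : nat -> bool) (i : nat) :
  i < n -> P i -> 0 < \sum_(i < n) P i.
Proof.
move=> lti Pi; rewrite -count_iota_sum -has_count; apply/hasP.
by exists i; rewrite ?mem_iota.
Qed.

Lemma pair_sum (k : nat) (c : nat -> bool) :
  (forall i, i < k -> c (i.*2).+1 = ~~ c i.*2) -> \sum_(i < k.*2) c i = k.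
Proof.
elim: k => [|k IH] h; first by rewrite big_ord0.
rewrite doubleS 2!big_ord_recr /= IH => [|i lti]; last by rewrite h // ltnW.
by rewrite h //; case: (c _); rewrite /= ?addn0 ?addn1.
Qed.

Lemma leq_cover2 (c1 c2 d1 d2 : bool) :
  (c1 || c2 -> d1 || d2) -> (c1 -> c2 -> d1 && d2) -> c1 + c2 <= d1 + d2.
Proof.
by case: c1 c2 d1 d2 => [] [] [] [] //= h1 h2; try by have := h1 isT; try by have := h2 isT isT.
Qed.

Lemma sorted_union (a b t t' : nat) (q u : nat -> nat -> nat) :
  (forall i, i < t -> gpath a b (q i)) -> (forall i, i < t' -> gpath a b (u i)) ->
  exists Y : nat -> nat -> nat,
  [/\ forall i, i < t + t' -> gpath a b (Y i),
      forall i j s, i <= j -> j < t + t' -> Y i s <= Y j s,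
      forall x v, cov t q x v || cov t' u x v ->
        exists2 i, i < t + t' & Y i (x + v) = v
    & forall x v, cov t q x v -> cov t' u x v ->
        exists i j, [/\ i < j, j < t + t', Y i (x + v) = v & Y j (x + v) = v]].
Proof.
move=> gq gu; pose P i := if i < t then q i else u (i - t).
have gP i : i < t + t' -> gpath a b (P i).
  by rewrite /P => lti; case: ltnP => lt; [exact: gq|apply: gu; rewrite ltn_subLR].
have [Y [gY sY cY]] := sort_family gP.
have sumP s v : \sum_(i < t + t') (P i s == v) = \sum_(i < t) (q i s == v) + \sum_(i < t') (u i s == v).
  rewrite big_split_ord /=; congr (_ + _); apply: eq_bigr => i _; rewrite /P /= ?ltn_ord //.
  by rewrite ltnNge leq_addr /= addKn.
have cq x v : cov t q x v -> 0 < \sum_(i < t) (q i (x + v) == v).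
  move=> /covP[i lti e]; apply: (@bool_sum_ge1 t (fun i => q i (x + v) == v) i) => //.
  by rewrite e.
have cu x v : cov t' u x v -> 0 < \sum_(i < t') (u i (x + v) == v).
  move=> /covP[i lti e]; apply: (@bool_sum_ge1 t' (fun i => u i (x + v) == v) i) => //.
  by rewrite e.
exists Y; split=> // x v.
  move=> h; have : 0 < \sum_(i < t + t') (Y i (x + v) == v).
    by rewrite -cY sumP; case/orP: h => [/cq|/cu]; lia.
  by move=> /(@bool_sum_gt0 _ (fun i => Y i (x + v) == v))[i lti /eqP e]; exists i.
move=> /cq h1 /cu h2; have : 1 < \sum_(i < t + t') (Y i (x + v) == v).
  by rewrite -cY sumP; lia.
move=> /(@bool_sum_gt1 _ (fun i => Y i (x + v) == v))[i [j [lij ljn /eqP e1 /eqP e2]]].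
by exists i, j.
Qed.

(** A cell of row [a] has the least column possible at its level, and path 0 is the leftmost
    path. *)
Lemma bottom_row_first (a b n : nat) (Y : nat -> nat -> nat) (v i : nat) :
  (forall i, i < n -> gpath a b (Y i)) ->
  (forall i j s, i <= j -> j < n -> Y i s <= Y j s) ->
  i < n -> v <= b -> Y i (a + v) = v -> Y 0 (a + v) = v.
Proof.
move=> gY sY lti lev e; have n0 : 0 < n by case: n lti {gY sY}.
have := sY 0 i (a + v) (leq0n _) lti.
have [|_ _] := gpath_bounds (gY 0 n0) (_ : a + v <= a + b); first by rewrite leq_add2l.
by lia.
Qed.

Lemma left_col_first (n : nat) (Y : nat -> nat -> nat) (x i : nat) :
  (forall i j s, i <= j -> j < n -> Y i s <= Y j s) ->
  i < n -> Y i (x + 0) = 0 -> Y 0 (x + 0) = 0.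
Proof. by move=> sY lti e; have := sY 0 i (x + 0) (leq0n _) lti; rewrite e leqn0 => /eqP. Qed.

Lemma right_col_last (a b n : nat) (Y : nat -> nat -> nat) (x i : nat) :
  (forall i, i < n -> gpath a b (Y i)) ->
  (forall i j s, i <= j -> j < n -> Y i s <= Y j s) ->
  i < n -> x <= a -> Y i (x + b) = b -> Y n.-1 (x + b) = b.
Proof.
move=> gY sY lti lex e; have n0 : n.-1 < n by case: n lti {gY sY}.
have := sY i n.-1 (x + b) _ n0.
have [|] := gpath_bounds (gY n.-1 n0) (_ : x + b <= a + b); first by rewrite leq_add2r.
by lia.
Qed.

Lemma even_odd_cov (n t t' : nat) (Y : nat -> nat -> nat) (x v i : nat) :
  t = uphalf n -> t' = n./2 -> i < n -> Y i (x + v) = v ->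
  if odd i then cov t' (fun j => Y (j.*2).+1) x v else cov t (fun j => Y j.*2) x v.
Proof.
move=> -> -> lti e; case: ifP => oi; apply/covP; exists i./2.
- by lia.
- by rewrite -[(i./2).*2.+1]/(true + (i./2).*2) -oi odd_double_half.
- by lia.
- by rewrite -[(i./2).*2]/(false + (i./2).*2) -oi odd_double_half.
Qed.

(** Sortedness squeezes path [i.+1] between [i] and [j], and consecutive indices have different
    parities. *)
Lemma even_odd_cov2 (n t t' : nat) (Y : nat -> nat -> nat) (x v i j : nat) :
  (forall i j s, i <= j -> j < n -> Y i s <= Y j s) ->
  t = uphalf n -> t' = n./2 -> i < j -> j < n -> Y i (x + v) = v -> Y j (x + v) = v ->
  cov t (fun j => Y j.*2) x v && cov t' (fun j => Y (j.*2).+1) x v.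
Proof.
move=> sY et et' lij ljn ei ej.
have e1 : Y i.+1 (x + v) = v.
  by apply/eqP; rewrite eqn_leq -{2}ej -{3}ei !sY // (leq_ltn_trans lij).
have := even_odd_cov et et' (ltn_trans lij ljn) ei.
have := even_odd_cov et et' (leq_ltn_trans lij ljn) e1.
by rewrite /=; case: (odd i) => /= -> ->.
Qed.

Lemma corner_first (a b n : nat) (Y : nat -> nat -> nat) :
  (forall i, i < n -> gpath a b (Y i)) -> 0 < n -> Y 0 (a + b) = b.
Proof. by move=> gY n0; have [] := gY 0 n0. Qed.

(** If row [a] is met, path 0 meets it, and if column [b] is met, path [k.*2] does. Both indices are
    even, so the even paths, given to the unrestricted family [X], cover the boundary; the corner
    comes for free, being the end of path 0. *)
Lemma exchange_same_ge (a b k t t' : nat) (q u : nat -> nat -> nat) :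
  t + t' = k.*2.+1 ->
  (forall i, i < t -> gpath a b (q i)) -> (forall i, i < t' -> gpath a b (u i)) ->
  exists X Z : nat -> nat -> nat,
  [/\ forall i, i < k.+1 -> gpath a b (X i), forall i, i < k -> gpath a b (Z i)
    & forall x v, x <= a -> v <= b ->
      ((x == a) && (v == b)) + (v < b) * cov t q x v + (x < a) * cov t' u x v
      <= cov k.+1 X x v + ((x < a) && (v < b)) * cov k Z x v].
Proof.
move=> ett gq gu; have [Y [gY sY cY1 cY2]] := sorted_union gq gu.
rewrite ett in gY sY cY1 cY2.
exists (fun j => Y j.*2), (fun j => Y (j.*2).+1); split=> [i lti|i lti|x v lex lev].
- by apply: gY; lia.
- by apply: gY; lia.
have e1 : k.+1 = uphalf k.*2.+1 by lia.
have e2 : k = (k.*2.+1)./2 by lia.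
have cX0 : Y 0 (x + v) = v -> cov k.+1 (fun j => Y j.*2) x v.
  by move=> e; apply/covP; exists 0.
have cXn : Y k.*2 (x + v) = v -> cov k.+1 (fun j => Y j.*2) x v.
  by move=> e; apply/covP; exists k.
have anyY : cov t q x v || cov t' u x v -> cov k.+1 (fun j => Y j.*2) x v || cov k (fun j => Y (j.*2).+1) x v.
  by move=> /cY1[i lti /(even_odd_cov e1 e2 lti)]; case: ifP => _ ->; rewrite ?orbT.
have twoY : cov t q x v -> cov t' u x v -> cov k.+1 (fun j => Y j.*2) x v && cov k (fun j => Y (j.*2).+1) x v.
  by move=> c1 c2; have [i [j [lij ljn ei ej]]] := cY2 _ _ c1 c2; exact: (even_odd_cov2 sY e1 e2 lij ljn ei ej).
have [ex|nx] := eqVneq x a.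
  subst x; rewrite ltnn andFb !mul0n !addn0; have [ev|nv] := eqVneq v b.
    by subst v; rewrite ltnn /= mul0n cX0 //; apply: corner_first gY _.
  rewrite add0n ltn_neqAle nv lev mul1n; case c: (cov t q a v) => //.
  have [|i lti e] := cY1 a v; first by rewrite c.
  by rewrite cX0 //; apply: (bottom_row_first gY sY lti lev e).
have ltx : x < a by rewrite ltn_neqAle nx.
rewrite ltx mul1n andTb; have [ev|nv] := eqVneq v b.
  subst v; rewrite ltnn !mul0n addn0; case c: (cov t' u x b) => //.
  have [|i lti e] := cY1 x b; first by rewrite c orbT.
  by rewrite cXn //; apply: (right_col_last gY sY lti) => //; apply: ltnW.
rewrite ltn_neqAle nv lev !mul1n add0n.
exact: leq_cover2.
Qed.

(** Row [a] and column 0 are now both taken care of by path 0, again an even one. The flag [z] tells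
    which of the two terms of the maximum is bounded. *)
Lemma exchange_opp_ge (a b k t t' : nat) (z : bool) (q u : nat -> nat -> nat) :
  t + t' = k.*2 ->
  (forall i, i < t -> gpath a b (q i)) -> (forall i, i < t' -> gpath a b (u i)) ->
  exists X Z : nat -> nat -> nat,
  [/\ forall i, i < k -> gpath a b (X i), forall i, i < k -> gpath a b (Z i)
    & forall x v, x <= a -> v <= b ->
      (if z then (0 < v) * cov t q x v + (x < a) * cov t' u x v
       else cov t q x v + ((x < a) && (0 < v)) * cov t' u x v)
      <= cov k X x v + ((x < a) && (0 < v)) * cov k Z x v].
Proof.
move=> ett gq gu; have [Y [gY sY cY1 cY2]] := sorted_union gq gu.
rewrite ett in gY sY cY1 cY2.
exists (fun j => Y j.*2), (fun j => Y (j.*2).+1); split=> [i lti|i lti|x v lex lev].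
- by apply: gY; lia.
- by apply: gY; lia.
have e1 : k = uphalf k.*2 by lia.
have e2 : k = (k.*2)./2 by lia.
have anyY : cov t q x v || cov t' u x v -> cov k (fun j => Y j.*2) x v || cov k (fun j => Y (j.*2).+1) x v.
  by move=> /cY1[i lti /(even_odd_cov e1 e2 lti)]; case: ifP => _ ->; rewrite ?orbT.
have twoY : cov t q x v -> cov t' u x v -> cov k (fun j => Y j.*2) x v && cov k (fun j => Y (j.*2).+1) x v.
  by move=> c1 c2; have [i [j [lij ljn ei ej]]] := cY2 _ _ c1 c2; exact: (even_odd_cov2 sY e1 e2 lij ljn ei ej).
have cX0 : ~~ ((x < a) && (0 < v)) -> cov t q x v || cov t' u x v -> cov k (fun j => Y j.*2) x v.
  move=> nc c; have [i lti e] := cY1 x v c; apply/covP; exists 0; first by case: (k) lti.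
  have [ex|nx] := eqVneq x a; first by subst x; apply: (bottom_row_first gY sY lti lev e).
  have v0 : v = 0 by move: nc; rewrite ltn_neqAle nx lex /=; case: (v).
  by subst v; apply: (left_col_first sY lti e).
case cr: ((x < a) && (0 < v)) cX0 => cX0; last first.
  rewrite mul0n !addn0; apply: (@leq_trans (cov t q x v || cov t' u x v)); last first.
    by case: (_ || _) cX0 => // -> .
  by case: z (x < a) (0 < v) (cov t q x v) (cov t' u x v) cr => [] [] [] [] [].
case/andP: cr => -> ->; rewrite !mul1n.
suff : cov t q x v + cov t' u x v <= cov k (fun j => Y j.*2) x v + cov k (fun j => Y (j.*2).+1) x v by case: z.
exact: leq_cover2.
Qed.

Lemma bool_sumC (n : nat) (c : nat -> bool) :
  \sum_(i < n) c i + \sum_(i < n) ~~ c i = n.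
Proof.
rewrite -big_split -[RHS]card_ord -sum1_card; apply: eq_bigr => i _ /=.
by case: (c i).
Qed.

Lemma chi_const_up (S s : nat) (c : nat -> bool) :
  s <= S -> (forall s', s <= s' < S -> c s'.+1 = c s') -> c S = c s.
Proof.
move=> leS; rewrite -(subnKC leS); elim: (S - s) => [|d IH] h; first by rewrite addn0.
rewrite addnS h ?IH ?addnS ?leq_addr ?ltnSn // => s' /andP[l1 l2].
by apply: h; rewrite l1 ltnW // addnS.
Qed.

Lemma gpath_bottom_row (a b : nat) (x : nat -> nat) (v s : nat) :
  gpath a b x -> v <= b -> x (a + v) = v -> a + v <= s <= a + b -> a <= s - x s.
Proof.
move=> gx lev e /andP[l1 l2]; have := gpath_lip gx l1 l2; rewrite e; lia.
Qed.

Lemma gpath_right_col (a b : nat) (x : nat -> nat) (u s : nat) :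
  gpath a b x -> x (u + b) = b -> u + b <= s <= a + b -> x s = b.
Proof.
move=> gx e /andP[l1 l2]; have := gpath_lip gx l1 l2; have [_ xT _] := gx.
by have := gpath_lip gx l2 (leqnn _); rewrite xT e; lia.
Qed.

(** The last step decides. A path that enters the corner along column [b] meets row [a] only there;
    any other path meets column [b] only there. The corner itself is paid for by the extra term. *)
Lemma exchange_same_le1 (a b : nat) (q : nat -> nat) :
  gpath a b q ->
  exists tx tz, tx + tz = 1 /\
    forall x v, x <= a -> v <= b ->
      (q (x + v) == v) <= ((x == a) && (v == b)) +
        (v < b) * cov tx (fun=> q) x v + (x < a) * cov tz (fun=> q) x v.
Proof.
move=> gq; have cE x v : cov 1 (fun=> q) x v = (q (x + v) == v) by rewrite /cov /= orbF.
have [qT|qT] := boolP ((0 < a) && (q (a + b).-1 == b)).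
  exists 0, 1; split=> // x v lex lev; rewrite cE.
  have [ltx|] := ltnP x a; first by rewrite mul1n leq_addl.
  move=> lax; have ex : x = a by lia.
  subst x; rewrite eqxx /=; case: eqP => // e.
  have [->|nv] := eqVneq v b; first by rewrite leq_addr.
  case/andP: qT => a0 /eqP qT.
  by have := gpath_lip gq (_ : a + v <= (a + b).-1) (leq_pred _); rewrite qT e; lia.
exists 1, 0; split=> // x v lex lev; rewrite cE.
case: eqP => // e; have [ltv|] := ltnP v b; first by rewrite mul1n addnAC leq_addl.
move=> lbv; have ev : v = b by lia.
subst v; rewrite eqxx /= andbT; have [->|nx] := eqVneq x a; first by rewrite leq_addr.
case/negP: qT; apply/andP; split; first by lia.
by apply/eqP; apply: (gpath_right_col gq e); lia.
Qed.

Lemma exchange_same_le (a b k : nat) (q u : nat -> nat -> nat) :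
  (forall i, i < k.+1 -> gpath a b (q i)) -> (forall i, i < k -> gpath a b (u i)) ->
  exists tx tz (X Z : nat -> nat -> nat),
  [/\ (tx = k.+1 /\ tz = k) \/ (tx = k /\ tz = k.+1),
      forall i, i < tx -> gpath a b (X i), forall i, i < tz -> gpath a b (Z i)
    & forall x v, x <= a -> v <= b ->
      cov k.+1 q x v + ((x < a) && (v < b)) * cov k u x v
      <= ((x == a) && (v == b)) + (v < b) * cov tx X x v + (x < a) * cov tz Z x v].
Proof.
(* With a single path the first and the last path coincide, and their final colours cannot differ as
   the general argument requires. *)
case: k => [|k] gq gu.
  have [tx [tz [e h]]] := exchange_same_le1 (gq 0 isT).
  exists tx, tz, (fun=> q 0), (fun=> q 0); split=> [|i _|i _|x v lex lev]; first by lia.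
  - exact: gq.
  - exact: gq.
  - by rewrite [cov 0 _ _ _]/= muln0 addn0 {1}/cov /= orbF; apply: h.
have [Y [gY sY cY1 cY2]] := sorted_union gq gu.
have en : k.+2 + k.+1 = (k.+1).*2.+1 by lia.
rewrite {}en in gY sY cY1 cY2.
(* Starts are paired as 0-1, 2-3, and so on, and the last one is left alone. Its colour decides
   between the two patterns of sizes. *)
pose h0 i := if i < (k.+1).*2 then if odd i then i.-1 else i.+1 else i.
have h0K i : h0 (h0 i) = i.
  rewrite {2}/h0; case: (ltnP i (k.+1).*2) => lti; last by rewrite /h0 ltnNge lti.
  case oi: (odd i).
    case: i oi lti => // i /= oi lti.
    by rewrite /h0 (ltnW lti) (negbTE oi).
  have lt1 : i.+1 < (k.+1).*2 by move: lti; rewrite -[i]odd_double_half oi; lia.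
  by rewrite /h0 lt1 /= oi.
have h0par i : h0 i != i -> odd (h0 i) = ~~ odd i.
  rewrite /h0; case: ifP => _; rewrite ?eqxx //; case: ifP => oi _; last by rewrite /= oi.
  by case: i oi => //= i; case: (odd i).
pose core s v := (v < b) && (s - v < a).
have [chi [bal1 bal2 two same [c0 cS _ cp]]] := @coloring a b _ Y core h0 sY h0K h0par.
have [X [gX cX]] := extract_family gY sY bal1.
have [Z [gZ cZ]] := @extract_family a b _ Y (fun s i => ~~ chi s i) gY sY bal2.
exists (\sum_(i < (k.+1).*2.+1) chi 0 i), (\sum_(i < (k.+1).*2.+1) ~~ chi 0 i), X, Z; split=> //.
  have := bool_sumC (k.+1).*2.+1 (chi 0).
  rewrite big_ord_recr /= pair_sum => [|i lti]; last first.
    have <- : h0 i.*2 = i.*2.+1 by rewrite /h0 ltn_double lti odd_double.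
    by apply: cp; rewrite /h0 ltn_double lti odd_double; lia.
  by case: (chi 0 _); lia.
move=> x v lex lev; have les : x + v <= a + b by apply: leq_add.
have toX i : i < (k.+1).*2.+1 -> Y i (x + v) = v -> chi (x + v) i -> cov (\sum_(i < (k.+1).*2.+1) chi 0 i) X x v.
  by move=> lti e c; have [j ltj ej] := cX _ i les lti c; apply/covP; exists j; rewrite ?ej.
have toZ i : i < (k.+1).*2.+1 -> Y i (x + v) = v -> ~~ chi (x + v) i -> cov (\sum_(i < (k.+1).*2.+1) ~~ chi 0 i) Z x v.
  by move=> lti e c; have [j ltj ej] := cZ _ i les lti c; apply/covP; exists j; rewrite ?ej.
have [ex|nx] := eqVneq x a.
  subst x; rewrite ltnn andFb !mul0n !addn0; have [ev|nv] := eqVneq v b; first by case: cov.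
  rewrite add0n ltn_neqAle nv lev mul1n; case c: (cov k.+2 q a v) => //.
  have [|i lti e] := cY1 a v; first by rewrite c.
  have e0 := bottom_row_first gY sY lti lev e.
  (* Once on row [a], path 0 stays off the core and so already has its final colour, [true]. *)
  rewrite (toX 0) // -(@chi_const_up (a + b).+1 (a + v) (chi^~ 0)) ?(leqW les) // => s /andP[l1 l2].
  by apply: same => //; rewrite /core negb_and orbC -leqNgt (gpath_bottom_row (gY 0 _) lev e0) // l1.
have ltx : x < a by rewrite ltn_neqAle nx.
rewrite ltx mul1n andTb add0n; have [ev|nv] := eqVneq v b.
  subst v; rewrite ltnn !mul0n addn0; case c: (cov k.+2 q x b) => //.
  have [|i lti e] := cY1 x b; first by rewrite c.
  have e0 : Y (k.+1).*2 (x + b) = b by apply: (right_col_last gY sY lti lex e).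
  (* The last path has an even nonzero index, hence final colour [false], and column [b] is off the
     core. *)
  rewrite (toZ (k.+1).*2) // -(@chi_const_up (a + b).+1 (x + b) (chi^~ (k.+1).*2)) ?(leqW les) //.
    by apply: cS; rewrite // odd_double.
  move=> s /andP[l1 l2]; apply: same => //.
  by rewrite (gpath_right_col (gY _ _) e0) ?l1 // /core ltnn.
have ltv : v < b by rewrite ltn_neqAle nv.
rewrite ltv !mul1n; apply: leq_cover2.
  move=> /cY1[i lti e]; case c: (chi (x + v) i); first by rewrite (toX i).
  by rewrite (toZ i) ?orbT ?c.
move=> c1 c2; have [i [j [lij ljn ei ej]]] := cY2 _ _ c1 c2.
have co : core (x + v) (Y i (x + v)) by rewrite ei /core ltv addnK.
have eij : Y i (x + v) = Y j (x + v) by rewrite ei.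
have [i1 [l1 c1' e1]] := two (x + v) i j true les lij ljn eij co.
have [i2 [l2 c2' e2]] := two (x + v) i j false les lij ljn eij co.
by rewrite (toX i1) ?c1' ?e1 // (toZ i2) ?c2' ?e2.
Qed.

(** Path 0 serves both boundaries, column 0 at its beginning and row [a] at its end, and it ends
    with colour [true]. If it also begins so, [X] takes the whole boundary and has two paths more
    than [Z]. Otherwise column 0 goes to [Z], row [a] to [X], and the sizes are equal. *)
Lemma exchange_opp_le (a b k : nat) (q u : nat -> nat -> nat) :
  (forall i, i < k.+1 -> gpath a b (q i)) -> (forall i, i < k.+1 -> gpath a b (u i)) ->
  (exists X Z : nat -> nat -> nat,
    [/\ forall i, i < k.+2 -> gpath a b (X i), forall i, i < k -> gpath a b (Z i)
      & forall x v, x <= a -> v <= b ->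
        cov k.+1 q x v + ((x < a) && (0 < v)) * cov k.+1 u x v
        <= cov k.+2 X x v + ((x < a) && (0 < v)) * cov k Z x v]) \/
  (exists X Z : nat -> nat -> nat,
    [/\ forall i, i < k.+1 -> gpath a b (X i), forall i, i < k.+1 -> gpath a b (Z i)
      & forall x v, x <= a -> v <= b ->
        cov k.+1 q x v + ((x < a) && (0 < v)) * cov k.+1 u x v
        <= (0 < v) * cov k.+1 X x v + (x < a) * cov k.+1 Z x v]).
Proof.
move=> gq gu.
have [Y [gY sY cY1 cY2]] := sorted_union gq gu.
have en : k.+1 + k.+1 = k.*2.+2 by lia.
rewrite {}en in gY sY cY1 cY2.
(* Starts are paired as 1-2, 3-4, and so on; paths 0 and [k.*2.+1] stay alone. The latter has an
   unpaired odd start, hence initial colour [true], so the sizes depend only on the initial colour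
   of path 0. *)
pose h0 i := if (0 < i) && (i < k.*2.+1) then if odd i then i.+1 else i.-1 else i.
have h0K i : h0 (h0 i) = i.
  rewrite {2}/h0; case: ifP => [/andP[i0 lti]|c]; last by rewrite /h0 c.
  case oi: (odd i).
    have lt1 : i.+1 < k.*2.+1.
      rewrite ltn_neqAle lti andbT; apply/eqP => -[e].
      by move: oi; rewrite e odd_double.
    by rewrite /h0 lt1 /= oi.
  case: i i0 lti oi => // -[|i] // _ lti /= oi.
  by rewrite /h0 /= (ltn_trans _ lti) // (negbFE oi).
have h0par i : h0 i != i -> odd (h0 i) = ~~ odd i.
  rewrite /h0; case: ifP => [/andP[i0 _]|_]; rewrite ?eqxx //; case: ifP => oi _; first by rewrite /= oi.
  by case: i oi i0 => //= i oi _; rewrite -[odd i]negbK oi.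
pose core s v := (0 < v) && (s - v < a).
have [chi [bal1 bal2 two same [c0 cS cN cp]]] := @coloring a b _ Y core h0 sY h0K h0par.
have [X [gX cX]] := extract_family gY sY bal1.
have [Z [gZ cZ]] := @extract_family a b _ Y (fun s i => ~~ chi s i) gY sY bal2.
have cl : chi 0 k.*2.+1 by apply: cN; rewrite /= ?odd_double // /h0 ltnn andbF.
have s1 : \sum_(i < k.*2.+2) chi 0 i = (chi 0 0 + k.+1)%N.
  rewrite big_ord_recl big_ord_recr /= (pair_sum (c := fun i => chi 0 i.+1)) => [|i lti]; last first.
    have <- : h0 i.*2.+1 = i.*2.+2 by rewrite /h0 /= ltnS ltn_double lti /= odd_double.
    by apply: cp; rewrite /h0 /= ltnS ltn_double lti /= odd_double /= neq_ltn !ltnS leqnn orbT.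
  by rewrite /bump leq0n add1n cl addn1.
have s2 : \sum_(i < k.*2.+2) ~~ chi 0 i = (~~ chi 0 0 + k)%N.
  by have := bool_sumC k.*2.+2 (chi 0); rewrite s1; case: (chi 0 0); lia.
rewrite s1 in gX cX; rewrite s2 in gZ cZ.
have toX x v i : x + v <= a + b -> i < k.*2.+2 -> Y i (x + v) = v -> chi (x + v) i -> cov (chi 0 0 + k.+1) X x v.
  by move=> les lti e c; have [j ltj ej] := cX _ i les lti c; apply/covP; exists j; rewrite ?ej.
have toZ x v i : x + v <= a + b -> i < k.*2.+2 -> Y i (x + v) = v -> ~~ chi (x + v) i -> cov (~~ chi 0 0 + k) Z x v.
  by move=> les lti e c; have [j ltj ej] := cZ _ i les lti c; apply/covP; exists j; rewrite ?ej.
have coreP x v : x < a -> 0 < v -> x <= a -> v <= b ->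
    cov k.+1 q x v + cov k.+1 u x v <= cov (chi 0 0 + k.+1) X x v + cov (~~ chi 0 0 + k) Z x v.
  move=> ltx v0 lex lev; have les : x + v <= a + b by apply: leq_add.
  apply: leq_cover2.
    move=> /cY1[i lti e]; case c: (chi (x + v) i); first by rewrite (toX x v i).
    by rewrite (toZ x v i) ?orbT ?c.
  move=> c1 c2; have [i [j [lij ljn ei ej]]] := cY2 _ _ c1 c2.
  have co : core (x + v) (Y i (x + v)) by rewrite ei /core v0 addnK.
  have eij : Y i (x + v) = Y j (x + v) by rewrite ei.
  have [i1 [l1 c1' e1]] := two (x + v) i j true les lij ljn eij co.
  have [i2 [l2 c2' e2]] := two (x + v) i j false les lij ljn eij co.
  by rewrite (toX x v i1) ?c1' ?e1 // (toZ x v i2) ?c2' ?e2.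
have row v : v <= b -> cov k.+1 q a v -> Y 0 (a + v) = v /\ chi (a + v) 0.
  move=> lev c; have [|i lti e] := cY1 a v; first by rewrite c.
  have e0 := bottom_row_first gY sY lti lev e; split=> //.
  rewrite -(@chi_const_up (a + b).+1 (a + v) (chi^~ 0)) ?leqW ?leq_add2l // => s /andP[l1 l2].
  by apply: same => //; rewrite /core negb_and orbC -leqNgt (gpath_bottom_row (gY 0 _) lev e0) // l1.
have col x : x <= a -> cov k.+1 q x 0 -> Y 0 (x + 0) = 0 /\ chi (x + 0) 0 = chi 0 0.
  move=> lex c; have [|i lti e] := cY1 x 0; first by rewrite c.
  have e0 := left_col_first sY lti e; split=> //.
  have les : x + 0 <= a + b by apply: leq_add.
  apply: (@chi_const_up (x + 0) 0 (chi^~ 0)) => // s /andP[_ lts]; apply: same.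
    by apply: leq_trans les; apply: ltnW.
  have := gpath_lip (gY 0 isT) (ltnW lts) les; rewrite e0 leqn0 => /andP[/eqP -> _].
  by rewrite /core ltnn.
case c00: (chi 0 0) gX gZ toX toZ coreP col => /= gX gZ toX toZ coreP col; [left|right].
  exists X, Z; split=> // x v lex lev; have les : x + v <= a + b by apply: leq_add.
  have [ex|nx] := eqVneq x a.
    subst x; rewrite ltnn andFb !mul0n !addn0; case c: (cov k.+1 q a v) => //.
    by have [e ch] := row v lev c; rewrite (toX a v 0).
  have ltx : x < a by rewrite ltn_neqAle nx.
  rewrite ltx andTb; have [v0|] := ltnP 0 v; first by rewrite !mul1n; apply: coreP.
  rewrite leqn0 => /eqP v0; subst v; rewrite !mul0n !addn0; case c: (cov k.+1 q x 0) => //.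
  by have [e ch] := col x lex c; rewrite (toX x 0 0).
exists X, Z; split=> // x v lex lev; have les : x + v <= a + b by apply: leq_add.
have [ex|nx] := eqVneq x a.
  subst x; rewrite ltnn andFb !mul0n !addn0; case c: (cov k.+1 q a v) => //.
  have [e ch] := row v lev c; case: v lev les c e ch => [|v] lev les c e ch.
    (* At the corner cell the row would give path 0 the colour [true] and the column the colour
       [false], so the cell is not visited. *)
    by have [_] := col a lex c; rewrite ch.
  by rewrite mul1n (toX a v.+1 0).
have ltx : x < a by rewrite ltn_neqAle nx.
rewrite ltx andTb mul1n; have [v0|] := ltnP 0 v; first by rewrite !mul1n; apply: coreP.
rewrite leqn0 => /eqP v0; subst v; rewrite !mul0n !addn0 add0n; case c: (cov k.+1 q x 0) => //.
by have [e ch] := col x lex c; rewrite (toZ x 0 0) // ch.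
Qed.

(** * Unions of chains of boxes *)

Definition sum2 (r s : nat) (G : nat -> nat -> nat) : nat :=
  \sum_(i < r) \sum_(j < s) G i j.

Lemma leq_sum2 (r s : nat) (G G' : nat -> nat -> nat) :
  (forall i j, i < r -> j < s -> G i j <= G' i j) -> sum2 r s G <= sum2 r s G'.
Proof. by move=> e; apply: leq_sum => i _; apply: leq_sum => j _; apply: e. Qed.

Lemma sum2D (r s : nat) (G G' : nat -> nat -> nat) :
  sum2 r s G + sum2 r s G' = sum2 r s (fun i j => G i j + G' i j).
Proof. by rewrite -big_split; apply: eq_bigr => i _; rewrite -big_split. Qed.

Lemma sum2_row (r s : nat) (G : nat -> nat -> nat) :
  sum2 r s G = sum2 r.+1 s (fun i j => (i < r) * G i j).
Proof.
rewrite [RHS]/sum2 big_ord_recr /= ltnn [X in _ + X]big1 ?addn0 => [|j _]; last by rewrite mul0n.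
by apply: eq_bigr => i _; apply: eq_bigr => j _; rewrite ltn_ord mul1n.
Qed.

Lemma sum2_col (r s : nat) (G : nat -> nat -> nat) :
  sum2 r s G = sum2 r s.+1 (fun i j => (j < s) * G i j).
Proof.
apply: eq_bigr => i _; rewrite [RHS]big_ord_recr /= ltnn mul0n addn0.
by apply: eq_bigr => j _; rewrite ltn_ord mul1n.
Qed.

Lemma sum2_corner (r s : nat) (G : nat -> nat -> nat) :
  sum2 r.+1 s.+1 (fun i j => ((i == r) && (j == s)) * G i j) = G r s.
Proof.
rewrite /sum2 big_ord_recr big1 /= => [|i _]; last first.
  by rewrite big1 // => j _; rewrite ltn_eqF ?ltn_ord.
rewrite big_ord_recr big1 /= => [|j _]; last by rewrite (ltn_eqF (ltn_ord j)) andbF.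
by rewrite !eqxx mul1n.
Qed.

Section Chains.

Variables (pr pc : nat -> nat).

(** Only the order of the positions enters, so they may have gaps, and may be shifted or reversed
    together. *)
Definition box_comparable (i j i' j' : nat) : bool :=
  (pr i <= pr i') && (pc j <= pc j') || (pr i' <= pr i) && (pc j' <= pc j).

Definition chain (r s : nat) (C : nat -> nat -> bool) : Prop :=
  forall i j i' j', i < r -> j < s -> i' < r -> j' < s ->
    C i j -> C i' j' -> box_comparable i j i' j'.

Definition covered (t : nat) (C : nat -> nat -> nat -> bool) (i j : nat) : bool :=
  has (fun k => C k i j) (iota 0 t).

(** A lower bound instead of an exact total makes this downward closed in [m], hence equivalent to
    [m <= gmax]. *)
Definition achieves (r s : nat) (F : nat -> nat -> nat) (t m : nat) : Prop :=
  exists C : nat -> nat -> nat -> bool,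
    (forall k, k < t -> chain r s (C k)) /\
    m <= sum2 r s (fun i j => covered t C i j * F i j).

Definition gmax (r s : nat) (F : nat -> nat -> nat) (t : nat) : nat :=
  \max_(m < (sum2 r s F).+1 | `[< achieves r s F t m >]) m.

Lemma gmax_ge (r s : nat) (F : nat -> nat -> nat) (t m : nat) :
  achieves r s F t m -> m <= gmax r s F t.
Proof.
move=> h; have ltm : m < (sum2 r s F).+1.
  rewrite ltnS; case: h => C [_ le]; apply: leq_trans le _.
  by apply: leq_sum2 => i j _ _; case: covered; rewrite ?mul1n.
by apply: (@leq_bigmax_cond _ _ (fun i : 'I__ => i : nat) (Ordinal ltm)); apply/asboolP.
Qed.

Lemma gmax_achieves (r s : nat) (F : nat -> nat -> nat) (t : nat) :
  achieves r s F t (gmax r s F t).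
Proof.
rewrite /gmax; apply: big_ind => [|x y hx hy|i /asboolP //].
  by exists (fun _ _ _ => false); split=> // k _ i j.
by rewrite /maxn; case: ifP.
Qed.

Lemma gmax_leP (r s : nat) (F : nat -> nat -> nat) (t m : nat) :
  (m <= gmax r s F t) <-> achieves r s F t m.
Proof.
split=> [le|]; last exact: gmax_ge.
by have [C [hC le']] := gmax_achieves r s F t; exists C; split=> //; apply: leq_trans le'.
Qed.

(** Every row is a chain and every column is a chain; the less numerous kind covers the matrix. *)
Lemma gmax_total (r s : nat) (F : nat -> nat -> nat) (t : nat) :
  minn r s <= t -> gmax r s F t = sum2 r s F.
Proof.
move=> let'; apply/eqP; rewrite eqn_leq; apply/andP; split.
  by apply/bigmax_leqP => m _; rewrite -ltnS.
apply: gmax_ge; case: (leqP r s) let' => _ let'.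
  exists (fun k i _ => i == k); split=> [k _ i j i' j' _ _ _ _ /eqP-> /eqP->|].
    by rewrite /box_comparable leqnn /= leq_total.
  apply: leq_sum2 => i j lti _; suff -> : covered t (fun k i _ => i == k) i j by rewrite mul1n.
  by apply/hasP; exists i; rewrite // mem_iota (leq_trans lti).
exists (fun k _ j => j == k); split=> [k _ i j i' j' _ _ _ _ /eqP-> /eqP->|].
  by rewrite /box_comparable leqnn /= !andbT leq_total.
apply: leq_sum2 => i j _ ltj; suff -> : covered t (fun k _ j => j == k) i j by rewrite mul1n.
by apply/hasP; exists j; rewrite // mem_iota (leq_trans ltj).
Qed.

Lemma gmax0 (r s : nat) (F : nat -> nat -> nat) : gmax r s F 0 = 0.
Proof.
have [C [_]] := gmax_achieves r s F 0.
by rewrite /sum2 big1 ?leqn0 => [/eqP//|i _]; rewrite big1.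
Qed.

Lemma gmax_mono (r s : nat) (F : nat -> nat -> nat) (t : nat) :
  gmax r s F t <= gmax r s F t.+1.
Proof.
have [C [hC le]] := gmax_achieves r s F t; apply: gmax_ge.
exists (fun k i j => (k < t) && C k i j); split=> [k _ i j i' j' h1 h2 h3 h4 /andP[lt c] /andP[_ c']|].
  exact: (hC k lt) c c'.
apply: leq_trans le _; apply: leq_sum2 => i j _ _; rewrite leq_mul2r; apply/orP; right.
case E: (covered t C i j) => //; rewrite lt0b; case/hasP: E => k.
rewrite mem_iota /= => lt c; apply/hasP; exists k; last by rewrite lt.
by rewrite mem_iota; exact: leqW.
Qed.

Lemma eq_gmax_fill (r s : nat) (F F' : nat -> nat -> nat) (t : nat) :
  (forall i j, i < r -> j < s -> F i j = F' i j) -> gmax r s F t = gmax r s F' t.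
Proof.
move=> e; apply/eqP; rewrite eqn_leq; apply/andP; split; apply/gmax_leP.
  have [C [hC le]] := gmax_achieves r s F t; exists C; split=> //; apply: leq_trans le _.
  by apply: leq_sum2 => i j h1 h2; rewrite e.
have [C [hC le]] := gmax_achieves r s F' t; exists C; split=> //; apply: leq_trans le _.
by apply: leq_sum2 => i j h1 h2; rewrite e.
Qed.

Lemma gpath_chain (a b r s : nat) (x : nat -> nat) :
  gpath a b x -> (forall i, i < r -> pr i <= a) -> (forall j, j < s -> pc j <= b) ->
  chain r s (fun i j => x (pr i + pc j) == pc j).
Proof.
move=> gx ha hb i j i' j' hi hj hi' hj' /eqP e /eqP e'; rewrite /box_comparable.
have := ha i hi; have := ha i' hi'; have := hb j hj; have := hb j' hj' => b1 b2 a1 a2.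
have [le|lt] := leqP (pr i + pc j) (pr i' + pc j').
  have := gpath_lip gx le; rewrite e e'; lia.
have := gpath_lip gx (ltnW lt); rewrite e e'; lia.
Qed.

(* The least lattice path lying weakly right of every cell of the chain. *)
Lemma chain_gpath (a b r s : nat) (C : nat -> nat -> bool) :
  chain r s C -> (forall i, i < r -> pr i <= a) -> (forall j, j < s -> pc j <= b) ->
  exists2 x, gpath a b x & forall i j, i < r -> j < s -> C i j -> x (pr i + pc j) = pc j.
Proof.
move=> hC ha hb.
pose x l := maxn (minn b (l - a)) (\max_(i < r) \max_(j < s | C i j) minn (pc j) (l - pr i)).
have xle l m : l - a <= m -> (forall i j, i < r -> j < s -> C i j -> minn (pc j) (l - pr i) <= m) -> x l <= m.
  move=> h1 h2; rewrite /x geq_max geq_min h1 orbT /=.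
  by apply/bigmax_leqP => i _; apply/bigmax_leqP => j c; apply: h2.
have xge l i j : i < r -> j < s -> C i j -> minn (pc j) (l - pr i) <= x l.
  move=> hi hj c; rewrite leq_max; apply/orP; right.
  apply: leq_trans (leq_bigmax (Ordinal hi)).
  exact: (@leq_bigmax_cond _ _ (fun j : 'I_s => minn (pc j) (l - pr i)) (Ordinal hj)).
have xge' l : minn b (l - a) <= x l by rewrite leq_maxl.
exists x; first split.
- apply/eqP; rewrite -leqn0; apply: xle => // i j _ _ _; rewrite sub0n minn0 //.
- apply/eqP; rewrite eqn_leq; apply/andP; split; last by apply: leq_trans (xge' _); lia.
  by apply: xle => [|i j _ hj _]; [lia|have := hb j hj; lia].
- move=> l ltl; apply/andP; split; rewrite {1}/x.
    rewrite geq_max; apply/andP; split; first by apply: leq_trans (xge' _); lia.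
    apply/bigmax_leqP => i _; apply/bigmax_leqP => j c.
    by apply: leq_trans (xge l.+1 i j _ _ c) => //; lia.
  rewrite geq_max; apply/andP; split; first by have := xge' l; lia.
  apply/bigmax_leqP => i _; apply/bigmax_leqP => j c.
  have := xge l i j (ltn_ord i) (ltn_ord j) c; lia.
move=> i j hi hj c; apply/eqP; rewrite eqn_leq; apply/andP; split; last first.
  by apply: leq_trans (xge _ i j hi hj c); lia.
apply: xle => [|i' j' hi' hj' c']; first by have := ha i hi; lia.
by have /orP[/andP[]|/andP[]] := hC i j i' j' hi hj hi' hj' c c'; lia.
Qed.

(** Completing chains to full lattice paths loses nothing: extra boxes only add weight, and cells of
    the grid without a box have none. *)
Lemma achieves_gpath (a b r s : nat) (F : nat -> nat -> nat) (t m : nat) :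
  (forall i, i < r -> pr i <= a) -> (forall j, j < s -> pc j <= b) ->
  achieves r s F t m <->
  exists2 X : nat -> nat -> nat, forall k, k < t -> gpath a b (X k)
    & m <= sum2 r s (fun i j => cov t X (pr i) (pc j) * F i j).
Proof.
move=> ha hb; split=> [[C [hC le]]|[X gX le]]; last first.
  exists (fun k i j => X k (pr i + pc j) == pc j); split=> // k /gX gk.
  exact: gpath_chain gk ha hb.
have ex k : exists x, k < t -> gpath a b x /\ forall i j, i < r -> j < s -> C k i j -> x (pr i + pc j) = pc j.
  case: (ltnP k t) => [lt|_]; last by exists (fun=> 0).
  by have [x gx ex] := chain_gpath (hC k lt) ha hb; exists x.
pose X k := projT1 (cid (ex k)).
have XP k : k < t -> gpath a b (X k) /\ forall i j, i < r -> j < s -> C k i j -> X k (pr i + pc j) = pc j.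
  exact: (projT2 (cid (ex k))).
exists X => [k /XP[]//|]; apply: leq_trans le _; apply: leq_sum2 => i j hi hj.
rewrite leq_mul2r; apply/orP; right; case E: (covered t C i j) => //.
case/hasP: E => k; rewrite mem_iota /= => lt c; rewrite lt0b; apply/covP; exists k => //.
by have [_] := XP k lt; apply.
Qed.

End Chains.

(** * Corner identities for maximal unions of chains *)

Lemma eq_gmax_pos (pr pc pr' pc' : nat -> nat) (r s : nat) (F : nat -> nat -> nat) (t : nat) :
  (forall i j i' j', i < r -> j < s -> i' < r -> j' < s ->
     box_comparable pr pc i j i' j' = box_comparable pr' pc' i j i' j') ->
  gmax pr pc r s F t = gmax pr' pc' r s F t.
Proof.
move=> e; apply/eqP; rewrite eqn_leq; apply/andP; split; apply/gmax_leP.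
  have [C [hC le]] := gmax_achieves pr pc r s F t; exists C; split=> // k lt i j i' j' h1 h2 h3 h4 c c'.
  by rewrite -e //; apply: hC c c'.
have [C [hC le]] := gmax_achieves pr' pc' r s F t; exists C; split=> // k lt i j i' j' h1 h2 h3 h4 c c'.
by rewrite e //; apply: hC c c'.
Qed.

(** The four rectangles are written as masks on the largest one, so that each inequality reduces,
    box by box, to an exchange inequality between coverage counts. The corner box is the end of
    every lattice path, whence the separate term [F r s]. *)
Lemma gmax_same_corner (pr pc : nat -> nat) (r s : nat) (F : nat -> nat -> nat) (k : nat) :
  (forall i, i < r -> pr i < pr r) -> (forall j, j < s -> pc j < pc s) ->
  gmax pr pc r.+1 s.+1 F k.+1 + gmax pr pc r s F k =
  F r s + maxn (gmax pr pc r.+1 s F k.+1 + gmax pr pc r s.+1 F k)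
               (gmax pr pc r.+1 s F k + gmax pr pc r s.+1 F k.+1).
Proof.
move=> hr hs; set a := pr r; set b := pc s.
have ra i : i < r.+1 -> pr i <= a by rewrite ltnS leq_eqVlt => /orP[/eqP->|/hr/ltnW].
have sb j : j < s.+1 -> pc j <= b by rewrite ltnS leq_eqVlt => /orP[/eqP->|/hs/ltnW].
have ra' i : i < r -> pr i <= a by move/hr/ltnW.
have sb' j : j < s -> pc j <= b by move/hs/ltnW.
have rE i : i < r.+1 -> (i < r) = (pr i < a) /\ (i == r) = (pr i == a).
  rewrite ltnS leq_eqVlt => /orP[/eqP->|lt]; first by rewrite !ltnn !eqxx.
  by rewrite lt hr // !ltn_eqF // hr.
have sE j : j < s.+1 -> (j < s) = (pc j < b) /\ (j == s) = (pc j == b).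
  rewrite ltnS leq_eqVlt => /orP[/eqP->|lt]; first by rewrite !ltnn !eqxx.
  by rewrite lt hs // !ltn_eqF // hs.
apply/eqP; rewrite eqn_leq; apply/andP; split.
  have /(achieves_gpath _ _ _ ra sb)[q gq leq] := gmax_achieves pr pc r.+1 s.+1 F k.+1.
  have /(achieves_gpath _ _ _ ra' sb')[u gu leu] := gmax_achieves pr pc r s F k.
  have [tx [tz [X [Z [sz gX gZ h]]]]] := exchange_same_le gq gu.
  suff le : gmax pr pc r.+1 s.+1 F k.+1 + gmax pr pc r s F k <=
      F r s + (gmax pr pc r.+1 s F tx + gmax pr pc r s.+1 F tz).
    apply: leq_trans le _; rewrite leq_add2l leq_max.
    by case: sz => -[-> ->]; rewrite leqnn ?orbT.
  apply: leq_trans (leq_add leq leu) _.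
  apply: leq_trans (leq_add (leqnn _) (leq_add
    (gmax_ge (iffRL (achieves_gpath F tx _ ra sb') (ex_intro2 _ _ X gX (leqnn _))))
    (gmax_ge (iffRL (achieves_gpath F tz _ ra' sb) (ex_intro2 _ _ Z gZ (leqnn _)))))).
  rewrite -(sum2_corner r s F) (sum2_row r s) !(sum2_col r.+1 s) (sum2_row r s.+1) !sum2D.
  apply: leq_sum2 => i j hi hj; have [-> ->] := rE i hi; have [-> ->] := sE j hj.
  have := h _ _ (ra i hi) (sb j hj); rewrite !mulnA -!mulnDl => le.
  by rewrite leq_mul2r; apply/orP; right; move: le; rewrite -mulnb; lia.
have side tx tz : tx + tz = k.*2.+1 ->
    F r s + (gmax pr pc r.+1 s F tx + gmax pr pc r s.+1 F tz) <=
    gmax pr pc r.+1 s.+1 F k.+1 + gmax pr pc r s F k.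
  move=> et.
  have /(achieves_gpath _ _ _ ra sb')[q gq leq] := gmax_achieves pr pc r.+1 s F tx.
  have /(achieves_gpath _ _ _ ra' sb)[u gu leu] := gmax_achieves pr pc r s.+1 F tz.
  have [X [Z [gX gZ h]]] := exchange_same_ge et gq gu.
  apply: leq_trans (leq_add (leqnn _) (leq_add leq leu)) _.
  apply: leq_trans (leq_add
    (gmax_ge (iffRL (achieves_gpath F k.+1 _ ra sb) (ex_intro2 _ _ X gX (leqnn _))))
    (gmax_ge (iffRL (achieves_gpath F k _ ra' sb') (ex_intro2 _ _ Z gZ (leqnn _))))).
  rewrite -(sum2_corner r s F) (sum2_row r s) !(sum2_col r.+1 s) (sum2_row r s.+1) !sum2D.
  apply: leq_sum2 => i j hi hj; have [-> ->] := rE i hi; have [-> ->] := sE j hj.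
  have := h _ _ (ra i hi) (sb j hj); rewrite !mulnA -!mulnDl => le.
  by rewrite leq_mul2r; apply/orP; right; move: le; rewrite -mulnb; lia.
by rewrite addn_maxr geq_max; apply/andP; split; apply: side; lia.
Qed.

(** With the new column at position 0 the corner is the lower left cell, which a lattice path may
    miss; so no corner entry is split off. *)
Lemma gmax_opp_corner0 (pr pc : nat -> nat) (r s : nat) (F : nat -> nat -> nat) (k : nat) :
  (forall i, i < r -> pr i < pr r) -> pc s = 0 -> (forall j, j < s -> 0 < pc j) ->
  gmax pr pc r.+1 s.+1 F k.+1 + gmax pr pc r s F k.+1 =
  maxn (gmax pr pc r.+1 s F k.+1 + gmax pr pc r s.+1 F k.+1)
       (gmax pr pc r.+1 s.+1 F k.+2 + gmax pr pc r s F k).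
Proof.
move=> hr s0 hs; set a := pr r; pose b := \max_(j < s) pc j.
have ra i : i < r.+1 -> pr i <= a by rewrite ltnS leq_eqVlt => /orP[/eqP->|/hr/ltnW].
have ra' i : i < r -> pr i <= a by move/hr/ltnW.
have sb' j : j < s -> pc j <= b.
  by move=> lt; apply: (leq_bigmax (F := fun j : 'I_s => pc j) (Ordinal lt)).
have sb j : j < s.+1 -> pc j <= b by rewrite ltnS leq_eqVlt => /orP[/eqP->|/sb' //]; rewrite s0.
have rE i : i < r.+1 -> (i < r) = (pr i < a).
  by rewrite ltnS leq_eqVlt => /orP[/eqP->|lt]; [rewrite !ltnn|rewrite lt hr].
have sE j : j < s.+1 -> (j < s) = (0 < pc j).
  by rewrite ltnS leq_eqVlt => /orP[/eqP->|lt]; [rewrite s0 !ltnn|rewrite lt hs].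
apply/eqP; rewrite eqn_leq; apply/andP; split.
  have /(achieves_gpath _ _ _ ra sb)[q gq leq] := gmax_achieves pr pc r.+1 s.+1 F k.+1.
  have /(achieves_gpath _ _ _ ra' sb')[u gu leu] := gmax_achieves pr pc r s F k.+1.
  rewrite leq_max; apply/orP.
  have [[X [Z [gX gZ h]]]|[X [Z [gX gZ h]]]] := exchange_opp_le gq gu; [right|left].
    apply: leq_trans (leq_add leq leu) _.
    apply: leq_trans (leq_add
      (gmax_ge (iffRL (achieves_gpath F k.+2 _ ra sb) (ex_intro2 _ _ X gX (leqnn _))))
      (gmax_ge (iffRL (achieves_gpath F k _ ra' sb') (ex_intro2 _ _ Z gZ (leqnn _))))).
    rewrite !(sum2_row r s) !(sum2_col r.+1 s) !sum2D.
    apply: leq_sum2 => i j hi hj; rewrite (rE i hi) (sE j hj).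
    have := h _ _ (ra i hi) (sb j hj); rewrite !mulnA -!mulnDl => le.
    by rewrite leq_mul2r; apply/orP; right; move: le; rewrite -mulnb; lia.
  apply: leq_trans (leq_add leq leu) _.
  apply: leq_trans (leq_add
    (gmax_ge (iffRL (achieves_gpath F k.+1 _ ra sb') (ex_intro2 _ _ X gX (leqnn _))))
    (gmax_ge (iffRL (achieves_gpath F k.+1 _ ra' sb) (ex_intro2 _ _ Z gZ (leqnn _))))).
  rewrite (sum2_row r s) !(sum2_col r.+1 s) (sum2_row r s.+1) !sum2D.
  apply: leq_sum2 => i j hi hj; rewrite (rE i hi) (sE j hj).
  have := h _ _ (ra i hi) (sb j hj); rewrite !mulnA -!mulnDl => le.
  by rewrite leq_mul2r; apply/orP; right; move: le; rewrite -mulnb; lia.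
rewrite geq_max; apply/andP; split.
  have /(achieves_gpath _ _ _ ra sb')[q gq leq] := gmax_achieves pr pc r.+1 s F k.+1.
  have /(achieves_gpath _ _ _ ra' sb)[u gu leu] := gmax_achieves pr pc r s.+1 F k.+1.
  have et : k.+1 + k.+1 = (k.+1).*2 by rewrite addnn.
  have [X [Z [gX gZ h]]] := @exchange_opp_ge a b _ _ _ true _ _ et gq gu.
  apply: leq_trans (leq_add leq leu) _.
  apply: leq_trans (leq_add
    (gmax_ge (iffRL (achieves_gpath F k.+1 _ ra sb) (ex_intro2 _ _ X gX (leqnn _))))
    (gmax_ge (iffRL (achieves_gpath F k.+1 _ ra' sb') (ex_intro2 _ _ Z gZ (leqnn _))))).
  rewrite (sum2_row r s) !(sum2_col r.+1 s) (sum2_row r s.+1) !sum2D.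
  apply: leq_sum2 => i j hi hj; rewrite (rE i hi) (sE j hj).
  have := h _ _ (ra i hi) (sb j hj); rewrite !mulnA -!mulnDl => le.
  by rewrite leq_mul2r; apply/orP; right; move: le; rewrite -mulnb; lia.
have /(achieves_gpath _ _ _ ra sb)[q gq leq] := gmax_achieves pr pc r.+1 s.+1 F k.+2.
have /(achieves_gpath _ _ _ ra' sb')[u gu leu] := gmax_achieves pr pc r s F k.
have et : k.+2 + k = (k.+1).*2 by lia.
have [X [Z [gX gZ h]]] := @exchange_opp_ge a b _ _ _ false _ _ et gq gu.
apply: leq_trans (leq_add leq leu) _.
apply: leq_trans (leq_add
  (gmax_ge (iffRL (achieves_gpath F k.+1 _ ra sb) (ex_intro2 _ _ X gX (leqnn _))))
  (gmax_ge (iffRL (achieves_gpath F k.+1 _ ra' sb') (ex_intro2 _ _ Z gZ (leqnn _))))).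
rewrite !(sum2_row r s) !(sum2_col r.+1 s) !sum2D.
apply: leq_sum2 => i j hi hj; rewrite (rE i hi) (sE j hj).
have := h _ _ (ra i hi) (sb j hj); rewrite !mulnA -!mulnDl => le.
by rewrite leq_mul2r; apply/orP; right; move: le; rewrite -mulnb; lia.
Qed.

Lemma gmax_opp_corner (pr pc : nat -> nat) (r s : nat) (F : nat -> nat -> nat) (k : nat) :
  (forall i, i < r -> pr i < pr r) -> (forall j, j < s -> pc s < pc j) ->
  gmax pr pc r.+1 s.+1 F k.+1 + gmax pr pc r s F k.+1 =
  maxn (gmax pr pc r.+1 s F k.+1 + gmax pr pc r s.+1 F k.+1)
       (gmax pr pc r.+1 s.+1 F k.+2 + gmax pr pc r s F k).
Proof.
move=> hr hs; pose pc' j := pc j - pc s.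
have sb j : j < s.+1 -> pc s <= pc j by rewrite ltnS leq_eqVlt => /orP[/eqP->|/hs/ltnW].
have E r' s' t : s' <= s.+1 -> gmax pr pc r' s' F t = gmax pr pc' r' s' F t.
  move=> le; apply: eq_gmax_pos => i j i' j' _ hj _ hj'.
  by rewrite /box_comparable /pc' !leq_sub2rE // sb // (leq_trans _ le).
rewrite !E //; apply: gmax_opp_corner0 => // [|j lt]; first by rewrite /pc' subnn.
by rewrite subn_gt0 hs.
Qed.

(** A half turn of the grid; it makes a row in first position the last one. *)
Lemma gmax_rev (pr pc : nat -> nat) (r s : nat) (F : nat -> nat -> nat) (t M : nat) :
  (forall i, i < r -> pr i <= M) -> (forall j, j < s -> pc j <= M) ->
  gmax pr pc r s F t = gmax (fun i => M - pr i) (fun j => M - pc j) r s F t.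
Proof.
move=> hr hs; apply: eq_gmax_pos => i j i' j' hi hj hi' hj'; rewrite /box_comparable.
by have := hr i hi; have := hr i' hi'; have := hs j hj; have := hs j' hj'; lia.
Qed.

Definition psum (mu : nat -> nat) (t : nat) : nat := \sum_(d < t) mu d.

Lemma psumS (mu : nat -> nat) (t : nat) : psum mu t.+1 = psum mu t + mu t.
Proof. by rewrite /psum big_ord_recr. Qed.

Lemma psum0 (mu : nat -> nat) : psum mu 0 = 0.
Proof. by rewrite /psum big_ord0. Qed.

(** * Local rules and growth diagrams *)

Definition interlaces (mu al : nat -> nat) : Prop := forall d, al d.+1 <= mu d <= al d.

(* [true] is Fomin's rule for RSK.  [false] is its Hillman-Grassl counterpart; there
   the corner entry [m] only shows up in the totals. *)
Definition local_rule (b : bool) (mu : nat -> nat) (m : nat) (al be nu : nat -> nat) : Prop :=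
  if b then nu 0 = m + maxn (al 0) (be 0) /\
    forall d, nu d.+1 + mu d = maxn (al d.+1) (be d.+1) + minn (al d) (be d)
  else (forall k, psum nu k.+1 + psum mu k.+1 =
          maxn (psum al k.+1 + psum be k.+1) (psum nu k.+2 + psum mu k)) /\
    exists K, forall k, K <= k -> psum nu k + psum mu k = psum al k + psum be k + m.

Lemma local_rule_interlaces b mu m al be nu :
  interlaces mu al -> interlaces mu be -> local_rule b mu m al be nu ->
  interlaces al nu /\ interlaces be nu.
Proof.
move=> ia ib; case: b => [[n0 nS]|[R _]].
  suff h d : [/\ nu d.+1 <= al d, al d <= nu d, nu d.+1 <= be d & be d <= nu d].
    by split=> d; have [h1 h2 h3 h4] := h d; apply/andP.
  have := nS d; have := ia d; have := ib d; case: d => [|d]; first by split; lia.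
  by have := nS d; have := ia d; have := ib d; split; lia.
have c d : psum al d + psum be d <= psum nu d + psum mu d.
  by case: d => [|d]; rewrite ?psum0 //; have := R d; lia.
have le d : nu d.+1 <= mu d by have := R d; rewrite !psumS; lia.
have or d : nu d.+1 = mu d \/ psum nu d.+1 + psum mu d.+1 = psum al d.+1 + psum be d.+1.
  by have := R d; rewrite !psumS; lia.
(* For [d > 0]: if [nu d] is the preceding part of [mu], interlacing makes it dominate [al d] and
   [be d]. Otherwise the partial sums up to [d] agree, and [c] at [d.+1] gives the first
   alternative. *)
have ge d : al d + be d <= nu d + mu d \/ maxn (al d) (be d) <= nu d.
  have := c d.+1; rewrite !psumS; case: d => [|d].
    by rewrite !psum0; lia.
  case: (or d) => [e|]; last by lia.
  by have := ia d; have := ib d; lia.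
by split=> d; have := ge d; have := le d; have := ia d; have := ib d; lia.
Qed.

Lemma psum_inj (mu mu' : nat -> nat) :
  (forall t, psum mu t = psum mu' t) -> forall d, mu d = mu' d.
Proof. by move=> e d; have := e d; have := e d.+1; rewrite !psumS; lia. Qed.

(** The [false] rule gives [psum nu k.+1] from [psum nu k.+2], so [nu] is determined downwards from
    the range where the totals fix it. *)
Lemma local_rule_fwd_inj b mu m al be nu nu' :
  local_rule b mu m al be nu -> local_rule b mu m al be nu' -> forall d, nu d = nu' d.
Proof.
case: b => [[n0 nS] [n0' nS'] [|d]|[R [K RK]] [R' [K' RK']]]; first by lia.
  by have := nS d; have := nS' d; lia.
apply: psum_inj; suff h n t : maxn K K' <= t + n -> psum nu t = psum nu' t.
  by move=> t; apply: (h (maxn K K')); lia.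
elim: n t => [|n IH] t le; first by have := RK t; have := RK' t; lia.
case: t le => [|t] le; first by rewrite !psum0.
by have := R t; have := R' t; rewrite (IH t.+2); lia.
Qed.

(** Read backwards the [false] rule climbs: it gives [psum mu k.+1] from [psum mu k], and the totals
    then yield the corner entry. *)
Lemma local_rule_bwd_inj b mu m mu' m' al be nu :
  local_rule b mu m al be nu -> local_rule b mu' m' al be nu ->
  (forall d, mu d = mu' d) /\ m = m'.
Proof.
case: b => [[n0 nS] [n0' nS']|[R [K RK]] [R' [K' RK']]].
  by split=> [d|]; [have := nS d; have := nS' d; lia|lia].
have e t : psum mu t = psum mu' t.
  elim: t => [|t IH]; first by rewrite !psum0.
  by have := R t; have := R' t; rewrite IH; lia.
split; first exact: psum_inj.
by have := RK (maxn K K'); have := RK' (maxn K K'); rewrite e; lia.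
Qed.

(* [excess k] is what remains of the corner entry after the first [k] parts. *)
Fixpoint excess (al be nu : nat -> nat) (k : nat) : nat :=
  if k is k'.+1 then
    let c := excess al be nu k' in
    c + nu k' + maxn (nu k) (al k' + be k' - nu k' - c) - (al k' + be k')
  else 0.

Lemma local_rule_exists b al be nu K :
  interlaces al nu -> interlaces be nu ->
  (forall d, K <= d -> [/\ al d = 0, be d = 0 & nu d = 0]) ->
  exists mu m, [/\ interlaces mu al, interlaces mu be & local_rule b mu m al be nu].
Proof.
move=> ia ib fin; case: b.
  exists (fun d => maxn (al d.+1) (be d.+1) + minn (al d) (be d) - nu d.+1), (nu 0 - maxn (al 0) (be 0)).
  split=> [d|d|].
  - by have := ia d; have := ib d; have := ia d.+1; have := ib d.+1; lia.
  - by have := ia d; have := ib d; have := ia d.+1; have := ib d.+1; lia.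
  - split=> [|d]; first by have := ia 0; have := ib 0; lia.
    by have := ia d; have := ib d; have := ia d.+1; have := ib d.+1; lia.
pose c := excess al be nu.
(* This is the rule solved for the next part of [mu]: [c d] is the surplus of
   [psum nu d + psum mu d] over [psum al d + psum be d], and [psum nu d.+1 + psum mu d] has been
   subtracted from both terms of the maximum. Truncation at 0 is harmless inside the maximum. *)
pose mu d := maxn (nu d.+1) (al d + be d - nu d - c d).
have cS k : c k.+1 + (al k + be k) = c k + nu k + mu k.
  by rewrite /c /= -/c -/(mu k) /mu; lia.
have E k : psum nu k + psum mu k = psum al k + psum be k + c k.
  elim: k => [|k IH]; first by rewrite !psum0.
  by rewrite !psumS; have := cS k; lia.
exists mu, (c K); split=> [d|d|].
- by rewrite /mu; have := ia d; have := ib d; have := ia d.+1; have := ib d.+1; lia.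
- by rewrite /mu; have := ia d; have := ib d; have := ia d.+1; have := ib d.+1; lia.
split=> [k|].
  have := E k.+1; rewrite !psumS; have := E k; have := cS k; rewrite /mu; lia.
exists K => k le; rewrite E; congr (_ + _).
rewrite -(subnKC le); elim: (k - K) => [|n IH]; first by rewrite addn0.
rewrite addnS; have := cS (K + n); rewrite /mu.
by have [-> -> ->] := fin _ (leq_addr n K); have [_ _ ->] := fin (K + n).+1 (leqW (leq_addr n K)); lia.
Qed.

Lemma initial_segment (p : nat) (P : pred nat) :
  (forall e, P e.+1 -> P e) -> (forall e, p <= e -> ~~ P e) ->
  forall e, P e = (e < \sum_(i < p) P i).
Proof.
move=> dec fin.
have down e d : d <= e -> P e -> P d.
  by move=> le; rewrite -(subnKC le); elim: (e - d) => [|n IH]; rewrite ?addn0 // addnS => /dec.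
have [k [lek kP]] : exists k, k <= p /\ forall e, P e = (e < k).
  have ex : exists k, ~~ P k by exists p; apply: fin.
  case: (ex_minnP ex) => k nPk mink; exists k; split; first by apply: mink; apply: fin.
  move=> e; apply/idP/idP => [Pe|ltek]; last by apply: contraLR ltek => /mink; rewrite leqNgt.
  by rewrite ltnNge; apply: contra nPk => le; apply: down Pe.
have sumk n : \sum_(i < n) (i < k) = minn n k.
  elim: n => [|n IH]; first by rewrite big_ord0 min0n.
  by rewrite big_ord_recr /= IH; lia.
move=> e; rewrite kP (eq_bigr (fun i : 'I_p => (i < k) : nat)) => [|i _]; last by rewrite kP.
by rewrite sumk (minn_idPr lek).
Qed.

(** * Fillings of a shape and growth diagrams *)

Section Growth.

Variables (p q : nat).

Definition is_shape (h : nat -> nat) : Prop :=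
  [/\ forall i, h i.+1 <= h i, forall i, p <= i -> h i = 0 & forall i, h i <= q].

(* Number of boxes of the diagram strictly below [(i, j)] on its diagonal. *)
Definition depth (h : nat -> nat) (i j : nat) : nat :=
  \sum_(e < p) (j + e.+1 < h (i + e.+1)).

Lemma shape_lt h i j i' : is_shape h -> j < h i -> i' <= i -> j < h i'.
Proof.
move=> [dec _ _] lt le; apply: leq_trans lt _.
by rewrite -(subnKC le); elim: (i - i') => [|n IH]; rewrite ?addn0 // addnS (leq_trans (dec _)).
Qed.

Lemma shape_row h i j : is_shape h -> j < h i -> i < p.
Proof. by move=> [_ fin _] lt; rewrite ltnNge; apply/negP => /fin e; rewrite e in lt. Qed.

Lemma shape_col h i j : is_shape h -> j < h i -> j < q.
Proof. by move=> [_ _ le] lt; apply: leq_trans (le i). Qed.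

Lemma depthP h i j e : is_shape h -> (j + e.+1 < h (i + e.+1)) = (e < depth h i j).
Proof.
move=> sh; apply: (@initial_segment p (fun e => j + e.+1 < h (i + e.+1))) => [d lt|d le].
  by apply: (@shape_lt _ (i + d.+2)) => //; [apply: leq_ltn_trans lt|]; lia.
by have [_ fin _] := sh; rewrite fin ?ltn0 //; lia.
Qed.

Lemma depth_unique h i j e :
  is_shape h -> j + e < h (i + e) -> h (i + e).+1 <= (j + e).+1 -> depth h i j = e.
Proof.
move=> sh lt le; apply/eqP; rewrite eqn_leq leqNgt -depthP // !addnS -leqNgt le /=.
by case: e lt {le} => // e; rewrite -depthP // !addnS.
Qed.

Lemma depth_spec h i j : is_shape h -> j < h i ->
  j + depth h i j < h (i + depth h i j) /\ h (i + depth h i j).+1 <= (j + depth h i j).+1.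
Proof.
move=> sh lt; split; last by rewrite leqNgt -[(j + _).+1]addnS -[(i + _).+1]addnS depthP // ltnn.
by case E: (depth h i j) => [|e]; [rewrite !addn0|rewrite depthP // E].
Qed.

Variable (G : (nat -> nat -> nat) -> nat -> nat -> nat -> nat).
Variable (rule : nat -> nat -> bool).
Hypothesis Gfin : forall F r s d, minn r s <= d -> G F r s d = 0.
Hypothesis Gloc : forall F F' r s d,
  (forall i j, i < r -> j < s -> F i j = F' i j) -> G F r s d = G F' r s d.
Hypothesis Grule : forall F r s, r < p -> s < q ->
  local_rule (rule r s) (G F r s) (F r s) (G F r.+1 s) (G F r s.+1) (G F r.+1 s.+1).

(** The invariants vanish on the axes, and the local rule carries interlacing from two sides of a
    unit square to the other two. *)
Lemma growth_interlaces F r s :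
  (r < p -> s <= q -> interlaces (G F r s) (G F r.+1 s)) /\
  (r <= p -> s < q -> interlaces (G F r s) (G F r s.+1)).
Proof.
elim: r s => [|r IHr] s.
  have hor s' : interlaces (G F 0 s') (G F 0 s'.+1) by move=> d; rewrite !Gfin ?min0n.
  split=> [ltp|_ _]; last exact: hor.
  elim: s => [|s IHs] les; first by move=> d; rewrite !Gfin ?minn0.
  by have [] := local_rule_interlaces (IHs (ltnW les)) (hor s) (Grule F ltp les).
have hor : r.+1 <= p -> s < q -> interlaces (G F r.+1 s) (G F r.+1 s.+1).
  move=> ltp lts; have [v _] := IHr s; have [_ h] := IHr s.
  by have [] := local_rule_interlaces (v ltp (ltnW lts)) (h (ltnW ltp) lts) (Grule F ltp lts).
split=> // ltp; elim: s {hor} => [|s IHs] les; first by move=> d; rewrite !Gfin ?minn0.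
have [v h] := IHr s.
have [ha _] := local_rule_interlaces (v (ltnW ltp) (ltnW les)) (h (ltnW (ltnW ltp)) les) (Grule F (ltnW ltp) les).
by have [] := local_rule_interlaces (IHs (ltnW les)) ha (Grule F ltp les).
Qed.

(** The lattice point is the far corner of the last box on the diagonal of [(i, j)]; parts are
    numbered from 0, starting at that last box. *)
Definition growth_map (F : nat -> nat -> nat) (h : nat -> nat) (i j : nat) : nat :=
  G F (i + depth h i j).+1 (j + depth h i j).+1 (depth h i j).

Definition increasing (h : nat -> nat) (g : nat -> nat -> nat) : Prop :=
  forall i j, (j.+1 < h i -> g i j <= g i j.+1) /\ (j < h i.+1 -> g i j <= g i.+1 j).

(** The right or lower neighbour of a box has the same depth or one less. In both cases the two
    lattice points are adjacent, and the two inequalities of interlacing settle the two cases. *)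
Lemma growth_map_increasing F h : is_shape h -> increasing h (growth_map F h).
Proof.
move=> sh i j; have [dec _ _] := sh; split=> lt.
  have [a1 a2] := depth_spec sh (ltnW lt); have [b1 b2] := depth_spec sh lt.
  have rb := shape_row sh b1; have cb := shape_col sh b1.
  have ra := shape_row sh a1; have ca := shape_col sh a1.
  rewrite /growth_map; set e := depth h i j in a1 a2 ra ca *; set e' := depth h i j.+1 in b1 b2 rb cb *.
  have le1 : e' <= e.
    rewrite leqNgt; apply/negP => lt1.
    have : (j + e).+1 < h (i + e).+1 by apply: (@shape_lt _ (i + e')) => //; lia.
    by rewrite ltnNge a2.
  have le2 : e <= e'.+1.
    rewrite leqNgt; apply/negP => lt1.
    have : (j.+1 + e').+1 < h (i + e').+1 by apply: (@shape_lt _ (i + e)) => //; lia.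
    by rewrite ltnNge b2.
  have [ee|ee] : e = e' \/ e = e'.+1 by lia.
    rewrite ee; have [_ /(_ rb)] := growth_interlaces F (i + e').+1 (j + e').+1.
    by rewrite -!addSn => /(_ cb e')/andP[].
  rewrite ee !addnS; have [/(_ _ _ e')] := growth_interlaces F (i + e').+1 (j + e').+2.
  rewrite ee addnS in ra; rewrite addSn in cb *.
  by move=> H _; have /andP[] := H ra cb.
have lt0 : j < h i by apply: leq_trans lt (dec i).
have [a1 a2] := depth_spec sh lt0; have [b1 b2] := depth_spec sh lt.
have rb := shape_row sh b1; have cb := shape_col sh b1.
have ra := shape_row sh a1; have ca := shape_col sh a1.
rewrite /growth_map; set e := depth h i j in a1 a2 ra ca *; set e' := depth h i.+1 j in b1 b2 rb cb *.
have le1 : e' <= e.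
  rewrite leqNgt; apply/negP => lt1.
  have : (j + e).+1 < h (i + e).+1 by apply: (@shape_lt _ (i.+1 + e')) => //; lia.
    by rewrite ltnNge a2.
have le2 : e <= e'.+1.
  rewrite leqNgt; apply/negP => lt1.
  have : (j + e').+1 < h (i.+1 + e').+1 by apply: (@shape_lt _ (i + e)) => //; lia.
    by rewrite ltnNge b2.
have [ee|ee] : e = e' \/ e = e'.+1 by lia.
  rewrite ee; have [/(_ rb cb e')] := growth_interlaces F (i + e').+1 (j + e').+1.
  by rewrite addSn => /andP[].
rewrite ee !addnS; have [_ H] := growth_interlaces F (i + e').+2 (j + e').+1.
rewrite ee addnS in ca; rewrite addSn in rb *.
by have /andP[] := H rb ca e'.
Qed.

(** Fillings are functions on all pairs, compared on [h] only, so that they keep their type while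
    the shape grows. *)
Definition bijective_on (h : nat -> nat) : Prop :=
  (forall F F', (forall i j, j < h i -> growth_map F h i j = growth_map F' h i j) ->
     forall i j, j < h i -> F i j = F' i j) /\
  (forall g, increasing h g -> exists F, forall i j, j < h i -> growth_map F h i j = g i j).

Lemma growth_map_end h R S F i j d : is_shape h -> S < h R -> h R.+1 <= S.+1 ->
  i + d = R -> j + d = S -> growth_map F h i j = G F R.+1 S.+1 d.
Proof.
move=> sh lt le eR eS; have e : depth h i j = d by apply: depth_unique; rewrite ?eR ?eS.
by rewrite /growth_map e eR eS.
Qed.

Section AddBox.

Variables (h : nat -> nat) (r m : nat).
Let h' i := if i == r then m.+1 else h i.
Hypotheses (sh : is_shape h) (sh' : is_shape h') (hr : h r = m).

Let lt_h' i j : j < h i -> j < h' i.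
Proof. by rewrite /h'; case: eqP => [->|//]; rewrite hr ltnS => /ltnW. Qed.

Let h'_lt i j : j < h' i -> j < h i \/ i = r /\ j = m.
Proof.
rewrite /h'; case: eqP => [->|_]; last by left.
by rewrite hr ltnS leq_eqVlt => /orP[/eqP->|]; [right|left].
Qed.

Let r_lt : r < p. Proof. by apply: (@shape_row h' r m sh'); rewrite /h' eqxx. Qed.
Let m_lt : m < q. Proof. by apply: (@shape_col h' r m sh'); rewrite /h' eqxx. Qed.

Let above i : i < r -> m.+1 <= h i.
Proof.
move=> lt; have : m < h' i by apply: (@shape_lt h' r) => //; rewrite /h' ?eqxx // ltnW.
by rewrite /h' ltn_eqF.
Qed.

Let below : h r.+1 <= m. Proof. by rewrite -hr; case: sh. Qed.

(** The invariants at the four corners of the new box: [nu], [al] and [be] are read off the larger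
    shape, on the diagonal of the box and on the two adjacent ones, and [mu] off the smaller
    shape. *)
Let nu_eq F i j d : i + d = r -> j + d = m -> growth_map F h' i j = G F r.+1 m.+1 d.
Proof.
apply: growth_map_end => //; rewrite /h' ?eqxx // gtn_eqF //.
by apply: leq_trans below _.
Qed.

Let al_eq F i j d : i + d = r -> (j + d).+1 = m -> growth_map F h' i j = G F r.+1 m d.
Proof.
move=> e1 e2; rewrite -e2; apply: growth_map_end => //; rewrite /h' ?eqxx ?gtn_eqF // -?e2 //.
  by rewrite e2.
Qed.

Let be_eq F i j d : (i + d).+1 = r -> j + d = m -> growth_map F h' i j = G F r m.+1 d.
Proof.
move=> e1 e2; rewrite -e1; apply: growth_map_end => //; rewrite /h' ?e1 ?eqxx //.
by rewrite ltn_eqF -?e1 // above // -e1.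
Qed.

Let mu_eq F i j d : (i + d).+1 = r -> (j + d).+1 = m -> growth_map F h i j = G F r m d.
Proof.
move=> e1 e2; rewrite -e1 -e2; apply: growth_map_end; rewrite ?e1 ?e2 ?hr //.
by apply: leq_trans (above _); rewrite -?e1 ?e2 // ltnW.
Qed.

Let off_eq F i j : i + m != j + r -> growth_map F h' i j = growth_map F h i j.
Proof.
move=> ne; suff e : depth h' i j = depth h i j by rewrite /growth_map e.
apply: eq_bigr => e _; rewrite /h'; case: eqP => // e1; rewrite e1 hr ltnS leq_eqVlt.
by case: eqP => // e2; move: ne; rewrite -e1 -e2; lia.
Qed.

(** The images on [h] and [h'] differ only along the diagonal of the new box, where [mu] gives way
    to [nu]. Inverting the local rule there leaves a problem on [h] and the entry of the box. *)
Lemma bijective_on_add_box : bijective_on h -> bijective_on h'.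
Proof.
move=> [inj sur]; split=> [F F' e|g gi].
  have fin F1 r' s' d : ~ (d < r' /\ d < s') -> G F1 r' s' d = 0 by move=> nd; apply: Gfin; lia.
  have nuE d : G F r.+1 m.+1 d = G F' r.+1 m.+1 d.
    have [[l1 l2]|nd] := pselect (d < r.+1 /\ d < m.+1); last by rewrite !fin.
    rewrite -!(@nu_eq _ (r - d) (m - d)) ?subnK //; apply: e.
    by apply: (@shape_lt h' r) => //; rewrite /h' ?eqxx; lia.
  have alE d : G F r.+1 m d = G F' r.+1 m d.
    have [[l1 l2]|nd] := pselect (d < r.+1 /\ d < m); last by rewrite !fin.
    rewrite -!(@al_eq _ (r - d) (m.-1 - d)) ?subnK //; try lia; apply: e.
    by apply: (@shape_lt h' r) => //; rewrite /h' ?eqxx; lia.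
  have beE d : G F r m.+1 d = G F' r m.+1 d.
    have [[l1 l2]|nd] := pselect (d < r /\ d < m.+1); last by rewrite !fin.
    rewrite -!(@be_eq _ (r.-1 - d) (m - d)) ?subnK //; try lia; apply: e.
    by apply: (@shape_lt h' r) => //; rewrite /h' ?eqxx; lia.
  have R1 := Grule F r_lt m_lt; have R2 := Grule F' r_lt m_lt.
  rewrite -(funext nuE) -(funext alE) -(funext beE) in R2.
  have [muE cE] := local_rule_bwd_inj R1 R2.
  move=> i j /h'_lt[lt|[-> ->] //]; apply: inj lt => {}i {}j lt.
  have [eij|ne] := eqVneq (i + m) (j + r); last by rewrite -!off_eq // e // lt_h'.
  have ltr : i < r.
    rewrite ltnNge; apply/negP => le; have := shape_lt sh lt le.
    by rewrite hr; lia.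
  by rewrite !(@mu_eq _ _ _ (r.-1 - i)) //; lia.
(* The default 0 agrees with the vanishing of [G] beyond the smaller side of a rectangle. *)
pose nu d := if (d <= r) && (d <= m) then g (r - d) (m - d) else 0.
pose al d := if (d <= r) && (d < m) then g (r - d) (m - d.+1) else 0.
pose be d := if (d < r) && (d <= m) then g (r - d.+1) (m - d) else 0.
have in_h' i j : i <= r -> j <= m -> j < h' i.
  by move=> l1 l2; apply: (@shape_lt h' r) => //; rewrite /h' eqxx.
have ga i j : i <= r -> j < m -> g i j <= g i j.+1 by move=> l1 l2; have [+ _] := gi i j; apply; apply: in_h'.
have gb i j : i < r -> j <= m -> g i j <= g i.+1 j by move=> l1 l2; have [_] := gi i j; apply; apply: in_h'.
have ia : interlaces al nu.
  move=> d; rewrite /al /nu; apply/andP; split.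
    case: ifP => // /andP[l1 l2]; rewrite (ltnW l1) l2 /=.
    by have := gb (r - d.+1) (m - d.+1); rewrite -subSn // subSS; apply; lia.
  case: ifP => // /andP[l1 l2]; rewrite l1 (ltnW l2) /=.
  by have := ga (r - d) (m - d.+1); rewrite -(subSn l2) subSS; apply; lia.
have ib : interlaces be nu.
  move=> d; rewrite /be /nu; apply/andP; split.
    case: ifP => // /andP[l1 l2]; rewrite l1 (ltnW l2) /=.
    by have := ga (r - d.+1) (m - d.+1); rewrite -(subSn l2) subSS; apply; lia.
  case: ifP => // /andP[l1 l2]; rewrite (ltnW l1) l2 /=.
  by have := gb (r - d.+1) (m - d); rewrite -(subSn l1) subSS; apply; lia.
have [|mu [c [ma mb R]]] := @local_rule_exists (rule r m) al be nu (r + m).+1 ia ib.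
  by move=> d le; split; rewrite /al /be /nu; case: ifP => // /andP[]; lia.
have mu0 d : minn r m <= d -> mu d = 0.
  move=> le; have := ma d; have := mb d; rewrite /al /be.
  have [l|l] := leqP r d => /=; first by lia.
  by have [l2|l2] := leqP m d => /=; rewrite ?andbF; lia.
(* The image wanted on the smaller shape; it is increasing because [mu] interlaces with [al] and
   [be]. In [h] the box of row [i] on this diagonal has depth [r - i.+1]. *)
pose g' i j := if (i < r) && (i + m == j + r) then mu (r - i.+1) else g i j.
have [|F FP] := sur g'.
  move=> i j; rewrite /g'; split=> lt.
    have lt' := lt_h' lt.
    case: ifP => [/andP[ltr /eqP e]|_].
      have -> : (i + m == j.+1 + r) = false by apply/eqP; lia.
      rewrite andbF; have /andP[_] := mb (r - i.+1); rewrite /be.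
      have -> : (r - i.+1 < r) && (r - i.+1 <= m) by lia.
      have -> : r - (r - i.+1).+1 = i by lia.
      by have -> : m - (r - i.+1) = j.+1 by lia.
    case: ifP => [/andP[ltr /eqP e]|_]; last by have [+ _] := gi i j; apply.
    have /andP[+ _] := ma (r - i.+1); rewrite /al.
    have -> : ((r - i.+1).+1 <= r) && ((r - i.+1).+1 < m) by lia.
    have -> : r - (r - i.+1).+1 = i by lia.
    by have -> : m - (r - i.+1).+2 = j by lia.
  have lt' := lt_h' lt.
  case: ifP => [/andP[ltr /eqP e]|_].
    have -> : (i.+1 + m == j + r) = false by apply/eqP; lia.
    rewrite andbF; have /andP[_] := ma (r - i.+1); rewrite /al.
    have ji : m = j + (r - i) by lia.
    have -> : (r - i.+1 <= r) && (r - i.+1 < m) by lia.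
    have -> : r - (r - i.+1) = i.+1 by lia.
    by have -> : m - (r - i.+1).+1 = j by lia.
  case: ifP => [/andP[ltr /eqP e]|_]; last by have [_] := gi i j; apply.
  have /andP[+ _] := mb (r - i.+2); rewrite /be.
  have -> : ((r - i.+2).+1 < r) && ((r - i.+2).+1 <= m) by lia.
  have -> : r - (r - i.+2).+2 = i by lia.
  by have -> : m - (r - i.+2).+1 = j by lia.
(* The entry of the new box can be chosen freely: by [loc], rectangles that do not contain the box
   ignore it. *)
pose F1 i j := if (i == r) && (j == m) then c else F i j.
have loc r' s' d : ~ (r < r' /\ m < s') -> G F1 r' s' d = G F r' s' d.
  move=> n; apply: Gloc => i j li lj; rewrite /F1; case: ifP => // /andP[/eqP e1 /eqP e2].
  by case: n; rewrite -e1 -e2.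
have in_h i j : j < h i -> growth_map F1 h i j = growth_map F h i j.
  move=> lt; apply: loc => -[l1 l2]; have [d1 _] := depth_spec sh lt.
  by have := shape_lt sh d1 (_ : r <= _); rewrite hr; lia.
exists F1 => i j lt.
have R1 := Grule F1 r_lt m_lt.
have muE d : G F1 r m d = mu d.
  rewrite loc; last by lia.
  have [l|l] := ltnP d (minn r m); last by rewrite Gfin ?mu0.
  rewrite -(@mu_eq _ (r - d.+1) (m - d.+1)); try lia.
  rewrite FP; last by apply: (@shape_lt h r.-1) => //; [apply: leq_trans (above _); lia|lia].
  have c1 : (r - d.+1 < r) && (r - d.+1 + m == m - d.+1 + r) by lia.
  by rewrite /g' c1; congr mu; lia.
have alE d : G F1 r.+1 m d = al d.
  rewrite /al; case: ifP => [/andP[l1 l2]|n]; last by apply: Gfin; lia.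
  rewrite -(@al_eq _ (r - d) (m - d.+1)); try lia.
  rewrite off_eq; last by lia.
  have lh : m - d.+1 < h (r - d) by apply: (@shape_lt h r) => //; rewrite ?hr; lia.
  have c1 : (r - d < r) && (r - d + m == m - d.+1 + r) = false by lia.
  by rewrite in_h // FP // /g' c1.
have beE d : G F1 r m.+1 d = be d.
  rewrite /be; case: ifP => [/andP[l1 l2]|n]; last by apply: Gfin; lia.
  rewrite -(@be_eq _ (r - d.+1) (m - d)); try lia.
  rewrite off_eq; last by lia.
  have lh : m - d < h (r - d.+1) by apply: leq_trans (above _); lia.
  have c1 : (r - d.+1 < r) && (r - d.+1 + m == m - d + r) = false by lia.
  by rewrite in_h // FP // /g' c1.
have nuE d : G F1 r.+1 m.+1 d = nu d.
  have Frm : F1 r m = c by rewrite /F1 !eqxx.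
  rewrite (funext muE) (funext alE) (funext beE) Frm in R1.
  exact: (local_rule_fwd_inj R1 R).
have [eij|ne] := eqVneq (i + m) (j + r).
  have ler : i <= r.
    rewrite leqNgt; apply/negP => ltr; have [lt2|[e _]] := h'_lt lt; last by lia.
    by have := shape_lt sh lt2 (ltnW ltr); rewrite hr; lia.
  rewrite (@nu_eq _ _ _ (r - i)); try lia.
  have c1 : (r - i <= r) && (r - i <= m) by lia.
  by rewrite nuE /nu c1; congr g; lia.
have [lt2|[e1 e2]] := h'_lt lt; last by move: ne; rewrite e1 e2 addnC eqxx.
by rewrite off_eq // in_h // FP // /g' (negbTE ne) andbF.
Qed.

End AddBox.

Lemma bijective_on_shape (l : nat -> nat) : is_shape l -> bijective_on l.
Proof.
move=> sl; have [dec fin le] := sl.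
(* Adding boxes row by row, from left to right, keeps every intermediate diagram a shape. *)
pose h r m i := if i < r then l i else if i == r then m else 0.
have hsh r m : m <= l r -> is_shape (h r m).
  move=> lem; split=> i.
  - rewrite /h; case: ltnP => [lt|ge]; first by rewrite (ltnW lt) dec.
    case: eqP => [e|_] //; rewrite -e in lem *; rewrite ltnSn; exact: leq_trans (dec i).
  - rewrite /h => /fin e; case: ifP => // _; case: eqP => // er.
    by apply/eqP; rewrite -leqn0 -e er.
  - by rewrite /h; case: ifP => // _; case: eqP => // _; apply: leq_trans (le r).
have step r m : m < l r -> bijective_on (h r m) -> bijective_on (h r m.+1).
  move=> ltm; have e : h r m.+1 = fun i => if i == r then m.+1 else h r m i.
    by apply: funext => i; rewrite /h; case: eqP => [->|//]; rewrite ltnn.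
  rewrite e; apply: bijective_on_add_box.
  - exact: hsh (ltnW ltm).
  - by rewrite -e; apply: hsh.
  - by rewrite /h ltnn eqxx.
have row r m : m <= l r -> bijective_on (h r 0) -> bijective_on (h r m).
  by elim: m => // m IH lt b; apply: step => //; apply: IH => //; apply: ltnW.
have all r : bijective_on (h r 0).
  elim: r => [|r IH].
    have e0 i j : (j < h 0 0 i) = false by rewrite /h /=; case: eqP.
    by split=> [F F' _ i j|g _]; [rewrite e0|exists (fun _ _ => 0) => i j; rewrite e0].
  have -> : h r.+1 0 = h r (l r).
    apply: funext => i; rewrite /h ltnS leq_eqVlt.
    by case: eqP => [->|_] /=; [rewrite ltnn|case: ifP => // _; case: eqP].
  exact: row.
have -> : l = h p 0; last exact: all.
apply: funext => i; rewrite /h; case: ltnP => // /fin ->; by case: eqP.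
Qed.

End Growth.

(** * Arcs of a Coxeter element *)

Section CoxeterProduct.

Variable n : nat.
Implicit Types (s : seq nat) (x : 'I_n.+1) (k : nat).

Lemma simple_tr_lt k i x : 1 <= i <= n -> i != k -> (simple_tr n i x < k) = (x < k).
Proof.
move=> /andP[i0 lei] ne; rewrite /simple_tr; case: tpermP => [->|->|//].
  by rewrite !inordK; lia.
by rewrite !inordK; lia.
Qed.

Lemma prod_simple_lt k s x : {subset s <= iota 1 n} -> k \notin s ->
  ((\prod_(i <- s) simple_tr n i)%g x < k) = (x < k).
Proof.
elim: s x => [|i s IH] x sub; first by rewrite big_nil perm1.
rewrite inE negb_or eq_sym => /andP[ne ks]; rewrite big_cons permM IH //.
  by apply: simple_tr_lt => //; have := sub i (mem_head _ _); rewrite mem_iota; lia.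
by move=> j js; apply: sub; rewrite inE js orbT.
Qed.

Lemma prod_simple_fix k s x : {subset s <= iota 1 n} -> k \notin s -> k.+1 \notin s ->
  x = k :> nat -> (\prod_(i <- s) simple_tr n i)%g x = k :> nat.
Proof.
move=> sub k1 k2 e; apply/eqP; rewrite eqn_leq -ltnS (prod_simple_lt _ sub) // e ltnSn /=.
by rewrite leqNgt (prod_simple_lt _ sub) // e ltnn.
Qed.

Variable c : 'S_(n.+1).
Hypothesis cox : coxeter c.

(** The generator of index [k] occurs once, and no other generator moves a point across the cut
    below [k]. *)
Lemma coxeter_split k : 1 <= k <= n ->
  exists P Q : 'S_(n.+1), [/\ c = (P * simple_tr n k * Q)%g,
    forall x, (P x < k) = (x < k) & forall x, (Q x < k) = (x < k)].
Proof.
move=> lek; have [s [ps ec]] := cox.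
have ks : k \in s by rewrite (perm_mem ps) mem_iota; lia.
have us : uniq s by rewrite (perm_uniq ps) iota_uniq.
have sub : {subset s <= iota 1 n} by move=> i; rewrite (perm_mem ps).
case/splitPr: ks us sub ec => s1 s2; rewrite cat_uniq /= => /and3P[_ /norP[k1 _] /andP[k2 _]] sub ec.
exists (\prod_(i <- s1) simple_tr n i)%g, (\prod_(i <- s2) simple_tr n i)%g; split.
- by rewrite ec big_cat big_cons /= mulgA.
- by move=> x; apply: prod_simple_lt k1 => i si; apply: sub; rewrite mem_cat si.
- by move=> x; apply: prod_simple_lt k2 => i si; apply: sub; rewrite mem_cat inE si !orbT.
Qed.

Lemma simple_tr_cross k x : 1 <= k <= n ->
  (simple_tr n k x < k) = (x < k) && (x.+1 != k) || (x == k :> nat).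
Proof.
move=> /andP[k0 lek]; rewrite /simple_tr; case: tpermP => [->|->|n1 n2].
- by rewrite !inordK; lia.
- by rewrite !inordK; lia.
have h1 : x.+1 != k by apply/eqP => e; apply: n1; apply: val_inj; rewrite /= inordK; lia.
have h2 : x != k :> nat by apply/eqP => e; apply: n2; apply: val_inj; rewrite /= inordK; lia.
by lia.
Qed.

(** The point that crosses upwards is the one that [P] brings to [k.-1], just under the cut. *)
Lemma coxeter_exit k : 1 <= k <= n ->
  exists2 x : 'I_n.+1, x < k <= c x & forall y : 'I_n.+1, y < k <= c y -> y = x.
Proof.
move=> lek; have [P [Q [ec hP hQ]]] := coxeter_split lek.
have E (x : 'I_n.+1) : (x < k <= c x) = ((P x).+1 == k).
  rewrite ec !permM [k <= _]leqNgt hQ simple_tr_cross // -(hP x) negb_or negb_and negbK.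
  by case: ltngtP; lia.
exists ((P^-1)%g (inord k.-1)); first by rewrite E permKV inordK; lia.
move=> y; rewrite E => /eqP e; apply: (@perm_inj _ P); rewrite permKV; apply: val_inj.
by rewrite /= inordK; lia.
Qed.

Lemma coxeter_entry k : 1 <= k <= n ->
  exists2 x : 'I_n.+1, c x < k <= x & forall y : 'I_n.+1, c y < k <= y -> y = x.
Proof.
move=> lek; have [P [Q [ec hP hQ]]] := coxeter_split lek.
have E (x : 'I_n.+1) : (c x < k <= x) = (P x == k :> nat).
  rewrite ec !permM hQ simple_tr_cross // [k <= x]leqNgt -(hP x).
  by case: ltngtP; lia.
exists ((P^-1)%g (inord k)); first by rewrite E permKV inordK; lia.
move=> y; rewrite E => /eqP e; apply: (@perm_inj _ P); rewrite permKV; apply: val_inj.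
by rewrite /= inordK; lia.
Qed.

(** Of the two generators that move [x], the one that occurs first carries it across its own cut;
    being used up, it cannot bring it back. *)
Lemma coxeter_nofix x : 0 < x < n -> c x != x.
Proof.
move=> ltx; pose k : nat := x; have [s [ps ec]] := cox.
have us : uniq s by rewrite (perm_uniq ps) iota_uniq.
have sub : {subset s <= iota 1 n} by move=> i; rewrite (perm_mem ps).
have ks : k \in s by rewrite (perm_mem ps) mem_iota /k; lia.
have ks' : k.+1 \in s by rewrite (perm_mem ps) mem_iota /k; lia.
have xk : x = inord k by rewrite /k inord_val.
case/splitPr: ks us sub ec ks' => s1 s2.
rewrite cat_uniq /= negb_or => /and4P[us1 /andP[k1 /hasPn dis] k2 us2] sub ec.
rewrite mem_cat inE gtn_eqF //= => /orP[ks1|ks2]; last first.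
  have e1 : (\prod_(i <- s1) simple_tr n i)%g x = k :> nat.
    apply: prod_simple_fix; rewrite ?(dis k.+1) // => i si.
    by apply: sub; rewrite mem_cat si.
  suff : c x < k by move=> lt; apply/eqP => e; rewrite e /k ltnn in lt.
  have -> : c = (\prod_(i <- s1) simple_tr n i * (simple_tr n k * \prod_(i <- s2) simple_tr n i))%g.
    by rewrite ec big_cat big_cons.
  rewrite !permM prod_simple_lt //; last first.
    by move=> i si; apply: sub; rewrite mem_cat inE si !orbT.
  rewrite simple_tr_cross; last by rewrite /k; lia.
  by apply/orP; right; apply/eqP.
have k1s2 : k.+1 \notin s2 by apply/negP => /dis; rewrite ks1.
case/splitPr: ks1 k1 us1 sub ec {dis} => t1 t2.
rewrite mem_cat inE !negb_or => /and3P[kt1 _ kt2].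
rewrite cat_uniq /= negb_or => /and4P[_ /andP[k1t1 _] k1t2 _] sub ec.
have e1 : (\prod_(i <- t1) simple_tr n i)%g x = k :> nat.
  by apply: prod_simple_fix => // i si; apply: sub; rewrite !mem_cat si.
suff : k < c x by move=> lt; apply/eqP => e; rewrite e /k ltnn in lt.
have -> : c = (\prod_(i <- t1) simple_tr n i * (simple_tr n k.+1 *
    \prod_(i <- t2 ++ k :: s2) simple_tr n i))%g by rewrite ec -catA big_cat big_cons.
rewrite !permM ltnNge -ltnS prod_simple_lt.
- rewrite simple_tr_cross; last by rewrite /k; lia.
  by move: e1 => /= ->; rewrite eqxx ltn_eqF // andbF.
- by move=> i si; apply: sub; rewrite -catA mem_cat inE si !orbT.
by rewrite mem_cat inE (negbTE k1t2) (negbTE k1s2) gtn_eqF.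
Qed.

End CoxeterProduct.

Section ArcOrder.

Variables (n : nat) (c : 'S_(n.+1)).
Hypothesis cox : coxeter c.

Local Notation f := (clab c).

Lemma clabE x : 0 < x <= n.+1 -> f x = (c (inord x.-1) : nat).+1.
Proof. by rewrite /clab => ->. Qed.

Lemma clab_range x : 0 < x <= n.+1 -> 0 < f x <= n.+1.
Proof. by move=> h; rewrite clabE //= ltn_ord. Qed.

Lemma clab_exit k x y : 0 < k <= n -> 0 < x <= k -> 0 < y <= k ->
  k < f x -> k < f y -> x = y.
Proof.
move=> hk hx hy; rewrite !clabE; try lia; rewrite !ltnS => fx fy.
have [z _ zu] := coxeter_exit cox hk.
have ez w : 0 < w <= n.+1 -> (inord w.-1 : 'I_n.+1) = w.-1 :> nat by move=> hw; rewrite inordK; lia.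
have : inord x.-1 = inord y.-1 :> 'I_n.+1.
  have -> : inord x.-1 = z by apply: zu; rewrite ez; lia.
  by have -> : inord y.-1 = z by apply: zu; rewrite ez; lia.
by move/(congr1 val); rewrite /= !inordK; lia.
Qed.

Lemma clab_exit_ex k : 0 < k <= n -> exists2 x, 0 < x <= k & k < f x.
Proof.
move=> hk; have [z /andP[zk fz] _] := coxeter_exit cox hk.
by exists z.+1 => //; rewrite clabE /= ?inord_val //; lia.
Qed.

Lemma clab_entry k x y : 0 < k <= n -> k < x <= n.+1 -> k < y <= n.+1 ->
  f x <= k -> f y <= k -> x = y.
Proof.
move=> hk hx hy; rewrite !clabE; try lia; move=> fx fy.
have [z _ zu] := coxeter_entry cox hk.
have ez w : 0 < w <= n.+1 -> (inord w.-1 : 'I_n.+1) = w.-1 :> nat by move=> hw; rewrite inordK; lia.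
have : inord x.-1 = inord y.-1 :> 'I_n.+1.
  have -> : inord x.-1 = z by apply: zu; rewrite ez; lia.
  by have -> : inord y.-1 = z by apply: zu; rewrite ez; lia.
by move/(congr1 val); rewrite /= !inordK; lia.
Qed.

Lemma clab_entry_ex k : 0 < k <= n -> exists2 x, k < x <= n.+1 & f x <= k.
Proof.
move=> hk; have [z /andP[fz zk] _] := coxeter_entry cox hk.
by exists z.+1; rewrite ?clabE /= ?inord_val //; have := ltn_ord z; lia.
Qed.

Lemma clab_nofix x : 1 < x <= n -> f x != x.
Proof.
move=> hx; rewrite clabE; last by lia.
have ix : (inord x.-1 : 'I_n.+1) = x.-1 :> nat by rewrite inordK; lia.
have := @coxeter_nofix n c cox (inord x.-1); rewrite ix => h.
apply/eqP => e; have /eqP[] : c (inord x.-1) != inord x.-1 by apply: h; lia.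
by apply: val_inj; rewrite /= ix -{2}e.
Qed.

Definition ascent (x : nat) : bool := x < f x.

(** Some label [w] up to [f x] is sent beyond [f x]. If it were not [f x] itself, then [w] and [x]
    would both cross the cut just below [f x]; so [w = x], which is absurd. *)
Lemma ascent_next x : 0 < x <= n -> ascent x -> f x <= n -> ascent (f x).
Proof.
rewrite /ascent => hx ax hf; have [w hw fw] := @clab_exit_ex (f x) ltac:(lia).
have [e|ne] := eqVneq w (f x); first by rewrite e in fw.
by have e : w = x; [apply: (@clab_exit (f x).-1); lia|rewrite e ltnn in fw].
Qed.

(** Otherwise [x] and [y] would both leave through the cut above [y], which lets out a single
    label. *)
Lemma ascent_gap x y : 0 < x -> y <= n -> ascent x -> ascent y -> x < y -> f x <= y.
Proof.
rewrite /ascent => x0 yn ax ay lt; rewrite leqNgt; apply/negP => lt2.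
by have := @clab_exit y x y; lia.
Qed.

Lemma descent_lt x : 1 < x <= n.+1 -> ~~ ascent x -> f x < x.
Proof.
move=> hx; rewrite /ascent -leqNgt => le; rewrite ltn_neqAle le andbT.
have [ltn|] := leqP x n; first by apply: clab_nofix; lia.
move=> h; have -> : x = n.+1 by lia.
have [w hw fw] := @clab_entry_ex n ltac:(lia).
have e : w = n.+1 by lia.
by rewrite e in fw; rewrite ltn_eqF.
Qed.

Lemma descent_next x : 1 < x <= n.+1 -> ~~ ascent x -> 1 < f x -> ~~ ascent (f x).
Proof.
move=> hx dx hf; have lt := descent_lt hx dx.
have [w hw fw] := @clab_entry_ex (f x).-1 ltac:(lia).
have [e|ne] := eqVneq w (f x); first by rewrite e in fw; rewrite /ascent; lia.
by have e : w = x; [apply: (@clab_entry (f x)); lia|rewrite e in fw; lia].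
Qed.

Lemma descent_gap x y : 1 < y -> x <= n.+1 -> ~~ ascent x -> ~~ ascent y -> y < x -> y <= f x.
Proof.
move=> y1 xn dx dy lt; have fy := @descent_lt y ltac:(lia) dy.
rewrite leqNgt; apply/negP => lt2.
by have := @clab_entry y.-1 x y; lia.
Qed.

Lemma ascent1 : 0 < n -> ascent 1.
Proof.
move=> n0; have [w hw fw] := @clab_exit_ex 1 ltac:(lia).
have e : w = 1 by lia.
by rewrite e in fw.
Qed.

(* Along the cycle of [c] the labels increase through the ascents up to
   [n+1], then decrease through the descents down to 1.  So the labels at most
   [k] form the arc ordered by [row_pos], the others the arc ordered by
   [col_pos]. *)
Definition row_pos (x : nat) : nat := if ascent x then n.+1 + x else n.+1 - x.
Definition col_pos (y : nat) : nat := if ascent y then y else 3 * n.+1 - y.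

Lemma row_pos_step k x : 0 < k <= n -> 0 < x <= k -> f x <= k -> row_pos x < row_pos (f x).
Proof.
move=> hk hx hf; rewrite /row_pos; case: ifP => ax.
  have az : ascent (f x) by apply: ascent_next => //; lia.
  rewrite az; have a : x < f x by [].
  by lia.
have x1 : 1 < x.
  by rewrite ltnNge; apply/negP => x1; have e : x = 1; [lia|move: ax; rewrite e ascent1; lia].
have := @descent_lt x ltac:(lia) (negbT ax); case: ifP => _; have := @clab_range x ltac:(lia); lia.
Qed.

(** Together with [row_pos_step]: [c] sends each label of the arc but the last to its immediate
    successor, so the arrows are the unit steps of a grid. *)
Lemma row_pos_next k x y : 0 < k <= n -> 0 < x <= k -> 0 < y <= k -> row_pos x < row_pos y ->
  f x <= k /\ row_pos (f x) <= row_pos y.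
Proof.
move=> hk hx hy; rewrite /row_pos; case: (boolP (ascent x)) => ax; case: (boolP (ascent y)) => ay lt.
- have g : f x <= y by apply: ascent_gap => //; lia.
  have az : ascent (f x) by apply: ascent_next => //; lia.
  by rewrite az; lia.
- by lia.
- have x1 : 1 < x.
    by rewrite ltnNge; apply/negP => x1; have e : x = 1; [lia|move: ax; rewrite e ascent1; lia].
  have fx := @descent_lt x ltac:(lia) ax; split; first by lia.
  case: ifP => // a; last by lia.
  suff : f x <= 1 by lia.
  by rewrite leqNgt; apply/negP => f1; have := @descent_next x ltac:(lia) ax f1; rewrite a.
have x1 : 1 < x.
  by rewrite ltnNge; apply/negP => x1; have e : x = 1; [lia|move: ax; rewrite e ascent1; lia].
have y1 : 1 < y.
  by rewrite ltnNge; apply/negP => y1; have e : y = 1; [lia|move: ay; rewrite e ascent1; lia].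
have fx := @descent_lt x ltac:(lia) ax; have g : y <= f x by apply: descent_gap => //; lia.
by rewrite (negbTE (@descent_next x ltac:(lia) ax _)); lia.
Qed.

Lemma col_pos_step k x : 0 < k <= n -> k < x <= n.+1 -> k < f x -> col_pos x < col_pos (f x).
Proof.
move=> hk hx hf; have rf := @clab_range x ltac:(lia); rewrite /col_pos; case: ifP => ax.
  have a : x < f x by [].
  by case: ifP => b; lia.
have fx := @descent_lt x ltac:(lia) (negbT ax).
by rewrite (negbTE (@descent_next x ltac:(lia) (negbT ax) _)); lia.
Qed.

Lemma col_pos_next k x y : 0 < k <= n -> k < x <= n.+1 -> k < y <= n.+1 -> col_pos x < col_pos y ->
  k < f x /\ col_pos (f x) <= col_pos y.
Proof.
move=> hk hx hy; have rf := @clab_range x ltac:(lia).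
have top z : z <= n.+1 -> ascent z -> z <= n.
  move=> le az; rewrite leqNgt; apply/negP => ge; have e : z = n.+1 by lia.
  by have := @clab_range z ltac:(lia); move: az; rewrite /ascent e; lia.
rewrite /col_pos; case: (boolP (ascent x)) => ax; case: (boolP (ascent y)) => ay lt.
- have yn : y <= n by apply: top; lia.
  have g : f x <= y by apply: ascent_gap => //; lia.
  have az : ascent (f x) by apply: ascent_next => //; lia.
  rewrite az; have a : x < f x by [].
  by lia.
- have a : x < f x by [].
  split; first by lia.
  have xn : x <= n by apply: top => //; lia.
  case: ifP => b; first by lia.
  suff : n < f x by lia.
  by rewrite ltnNge; apply: contraFN b => le; apply: ascent_next => //; lia.
- by lia.
have g : y <= f x by apply: descent_gap => //; lia.
by rewrite (negbTE (@descent_next x ltac:(lia) ax _)); lia.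
Qed.

End ArcOrder.

(** * Paths of the quiver and chains of the grid *)

Lemma path_pairwise_comparable (T : eqType) (e : rel T) (x : T) (q : seq T) :
  reflexive e -> transitive e -> path e x q ->
  {in x :: q &, forall v w, e v w || e w v}.
Proof.
move=> rf tr; elim: q x => [|y q IH] x /=.
  by move=> _ v w; rewrite !inE => /eqP-> /eqP->; rewrite rf.
move=> xq v w; have xall := order_path_min tr (xq : path e x (y :: q)).
have lex u : u \in y :: q -> e x u by move=> h; exact: (allP xall).
case/andP: xq => _ yq; rewrite ![_ \in x :: _]in_cons.
case/orP=> [/eqP->|hv]; case/orP=> [/eqP->|hw]; rewrite ?rf ?lex ?orbT //.
exact: IH yq v w hv hw.
Qed.

Definition vrow (n : nat) (v : ARvert n) : nat := v.1.
Definition vcol (n : nat) (v : ARvert n) : nat := v.2.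

Lemma vert_inj (n : nat) (v w : ARvert n) : vrow v = vrow w -> vcol v = vcol w -> v = w.
Proof. by case: v w => v1 v2 [w1 w2] /val_inj/= -> /val_inj/= ->. Qed.

Section ARGrid.

Variables (n k : nat) (c : 'S_(n.+1)).
Hypotheses (cox : coxeter c) (hk : 0 < k <= n).

Local Notation f := (clab c).
Local Notation rp := (row_pos c).
Local Notation cp := (col_pos c).

Definition vle : rel (ARvert n) := fun v w => (rp (vrow v) <= rp (vrow w)) && (cp (vcol v) <= cp (vcol w)).

Lemma vle_refl : reflexive vle.
Proof. by move=> v; rewrite /vle !leqnn. Qed.

Lemma vle_trans : transitive vle.
Proof.
move=> v u w /andP[a1 a2] /andP[b1 b2].
by rewrite /vle (leq_trans a1) // (leq_trans a2).
Qed.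

Lemma AR_kP (v : ARvert n) :
  reflect (0 < (vrow v) <= k /\ k < (vcol v) <= n.+1) (v \in AR_k n k).
Proof.
clear hk.
rewrite !inE /vrow /vcol; case: v => [[x hx] [y hy]] /=.
by apply: (iffP idP); lia.
Qed.

Lemma AR_arrow_vle : {in AR_k n k &, forall v w, AR_arrow c v w -> vle v w}.
Proof.
move=> v w /AR_kP[v1 v2] /AR_kP[w1 w2] /orP[|] /and3P[/eqP e1 /eqP e2 _].
  have {}e1 : vrow w = vrow v := e1; have {}e2 : vcol w = f (vcol v) := e2.
  rewrite /vle e1 e2 leqnn /=; apply/ltnW/(col_pos_step cox hk) => //.
  by rewrite -e2; lia.
have {}e1 : vcol w = vcol v := e1; have {}e2 : vrow w = f (vrow v) := e2.
rewrite /vle e1 e2 leqnn andbT /=; apply/ltnW/(row_pos_step cox hk) => //.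
by rewrite -e2; lia.
Qed.

Lemma gpath_vle p : is_gpath (AR_arrow c) (AR_k n k) p -> {in p &, forall v w, vle v w || vle w v}.
Proof.
case: p => // x q /andP[pq al]; apply: path_pairwise_comparable.
- exact: vle_refl.
- exact: vle_trans.
by apply: (sub_in_path AR_arrow_vle).
Qed.

Lemma row_pos_inj x y : 0 < x <= n.+1 -> 0 < y <= n.+1 -> rp x = rp y -> x = y.
Proof.
clear cox hk.
by rewrite /row_pos; case: ifP => _; case: ifP => _; lia. Qed.

Lemma col_pos_inj x y : 0 < x <= n.+1 -> 0 < y <= n.+1 -> cp x = cp y -> x = y.
Proof.
clear cox hk.
by rewrite /col_pos; case: ifP => _; case: ifP => _; lia. Qed.

(** Rows are advanced before columns, one arrow at a time. Both coordinates stay in their arcs, on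
    the two sides of [k], so the side conditions of the arrows hold. *)
Lemma vle_connect (v w : ARvert n) : v \in AR_k n k -> w \in AR_k n k -> vle v w ->
  exists q, [/\ path (AR_arrow c) v q, last v q = w & all (mem (AR_k n k)) q].
Proof.
move=> vA wA; have [d] := ubnP ((rp (vrow w) + cp (vcol w)) - (rp (vrow v) + cp (vcol v))).
elim: d v vA => // d IH v vA ltd /andP[l1 l2].
have /AR_kP[v1 v2] := vA; have /AR_kP[w1 w2] := wA.
have go u : u \in AR_k n k -> AR_arrow c v u -> rp (vrow v) + cp (vcol v) < rp (vrow u) + cp (vcol u) -> vle u w ->
    exists q, [/\ path (AR_arrow c) v q, last v q = w & all (mem (AR_k n k)) q].
  move=> uA vu lt le; have [|q [pq lq aq]] := IH u uA _ le.
    by have /andP[] := le; lia.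
  by exists (u :: q); split=> //=; rewrite ?vu //; apply/andP.
have [lr|er] := ltnP (rp (vrow v)) (rp (vrow w)).
  have [fk le] := row_pos_next cox hk v1 w1 lr.
  have st := row_pos_step cox hk v1 fk.
  have rf := @clab_range n c (vrow v) ltac:(lia).
  pose u : ARvert n := (inord (f (vrow v)), v.2).
  have u1 : vrow u = f (vrow v) by apply: inordK; lia.
  apply: (go u).
  - by apply/AR_kP; rewrite u1; split; [|exact: v2]; lia.
  - have lt : f (vrow v) < vcol v by lia.
    by apply/orP; right; apply/and3P; split; [|apply/eqP|].
  - by rewrite u1 ltn_add2r.
  - by rewrite /vle u1 le.
have e1 : vrow v = vrow w by apply: row_pos_inj; lia.
have [lc|ec] := ltnP (cp (vcol v)) (cp (vcol w)).
  have [fk le] := col_pos_next cox hk v2 w2 lc.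
  have st := col_pos_step cox hk v2 fk.
  have rf := @clab_range n c (vcol v) ltac:(lia).
  pose u : ARvert n := (v.1, inord (f (vcol v))).
  have u2 : vcol u = f (vcol v) by apply: inordK; lia.
  apply: (go u).
  - by apply/AR_kP; rewrite u2; split; [exact: v1|]; lia.
  - have lt : vrow v < f (vcol v) by lia.
    by apply/orP; left; apply/and3P; split; [|apply/eqP|].
  - by rewrite u2 ltn_add2l.
  - by rewrite /vle u2 le l1.
have e2 : vcol v = vcol w by apply: col_pos_inj; lia.
by exists [::]; split=> //=; apply: vert_inj.
Qed.

Lemma sorted_vle_gpath (x : ARvert n) s : x \in AR_k n k -> all (mem (AR_k n k)) s ->
  path vle x s -> exists q, [/\ path (AR_arrow c) x q, all (mem (AR_k n k)) q & {subset s <= x :: q}].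
Proof.
elim: s x => [|y s IH] x xA; first by exists [::].
move=> /= /andP[yA sA] /andP[xy ys].
have [q1 [p1 l1 a1]] := vle_connect xA yA xy.
have [q2 [p2 a2 s2]] := IH y yA sA ys.
exists (q1 ++ q2); split.
- by rewrite cat_path p1 l1.
- by rewrite all_cat a1.
have yq : y \in x :: q1 by rewrite -l1 mem_last.
move=> z; rewrite inE => /orP[/eqP->|/s2].
  by rewrite -cat_cons mem_cat yq.
by rewrite inE => /orP[/eqP->|zq]; rewrite -cat_cons mem_cat ?yq // zq orbT.
Qed.

Lemma chain_gpath_AR (D : {set ARvert n}) : D \subset AR_k n k ->
  {in D &, forall v w, vle v w || vle w v} ->
  exists2 p, is_gpath (AR_arrow c) (AR_k n k) p & {subset D <= p}.
Proof.
move=> DA cD; pose key (v : ARvert n) := rp (vrow v) + cp (vcol v).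
pose s := sort (relpre key leq) (enum D).
have sD v : (v \in s) = (v \in D) by rewrite mem_sort mem_enum.
have ss : sorted vle s.
  have : sorted (relpre key leq) s by apply: sort_sorted => v w; apply: leq_total.
  apply: (@sub_in_sorted _ (mem D)); last by apply/allP => v; rewrite sD.
  move=> v w vD wD; rewrite /= /key => le; have := cD v w vD wD; rewrite /vle; lia.
have sA : all (mem (AR_k n k)) s by apply/allP => v; rewrite sD => /(subsetP DA).
case: s sD ss sA => [|x s] sD ss sA; last first.
  move: sA => /= /andP[xA sA]; have [q [pq aq sq]] := sorted_vle_gpath xA sA ss.
  exists (x :: q) => [|v]; first by rewrite /= pq xA.
  by rewrite -sD inE => /orP[/eqP->|/sq //]; rewrite mem_head.
(* Paths are nonempty, so an empty [D] needs some vertex of [AR_k n k]. *)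
have xA : ((inord k, inord k.+1) : ARvert n) \in AR_k n k by apply/AR_kP; rewrite /vrow /vcol /= !inordK; lia.
by exists [:: (inord k, inord k.+1)] => [|v]; [rewrite /= xA|rewrite -sD].
Qed.

End ARGrid.

(** * Boxes and labels *)

Section Partition.

Variable la : seq nat.
Hypothesis hla : is_partition la.

Local Notation l := (nth 0 la).
Local Notation p := (size la).
Local Notation q := (head 0 la).

Lemma part_anti i j : i <= j -> l j <= l i.
Proof.
move=> le; have [ltj|] := ltnP j p; last by move=> ge; rewrite nth_default.
have /andP[srt _] := hla.
have := @sorted_leq_nth _ geq (rev_trans leq_trans) leqnn 0 la srt i j.
by rewrite !inE ltj (leq_ltn_trans le ltj) => /(_ isT isT le).
Qed.

Lemma part_gt0 i : i < p -> 0 < l i.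
Proof. by move=> lt; have /andP[_ /all_nthP] := hla; apply. Qed.

Lemma part_shape : is_shape p q l.
Proof.
split=> i; first exact: part_anti.
- exact: nth_default.
- by rewrite -nth0; apply: part_anti.
Qed.

Lemma conj_partP i j : (i < count (fun m => j < m) la) = (j < l i).
Proof.
rewrite -sum1_count (big_nth 0) big_mkord big_mkcond /=.
rewrite (@initial_segment p (fun e => j < l e)).
- by congr (_ < _); apply: eq_bigr => e _; case: (_ < _).
- by move=> e lt; apply: leq_trans lt (part_anti (leqnSn e)).
- by move=> e le; rewrite nth_default.
Qed.

Lemma cell_inj (x y : cell la) : crow x = crow y -> ccol x = ccol y -> x = y.
Proof.
case: x y => [[i j] hx] [[i' j'] hy]; rewrite /crow /ccol /= => e1 e2; apply: val_inj => /=.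
by congr (_, _); apply: val_inj.
Qed.

Lemma cell_lt (x : cell la) : ccol x < l (crow x).
Proof. exact: (valP x). Qed.

Lemma cell_ex i j : j < l i -> exists x : cell la, crow x = i /\ ccol x = j.
Proof.
move=> lt; have hi := shape_row part_shape lt; have hj := shape_col part_shape lt.
by exists (Sub (Ordinal hi, Ordinal hj) lt).
Qed.

(** Extension by 0: the sum has at most one term. *)
Definition extend (f : {ffun cell la -> nat}) (i j : nat) : nat :=
  \sum_(x | (crow x == i) && (ccol x == j)) f x.

Lemma extendE f x : extend f (crow x) (ccol x) = f x.
Proof. by rewrite /extend (big_pred1 x). Qed.

Lemma sum_delta (R a : nat) (g : nat -> nat) : \sum_(i < R) (a == i) * g i = (a < R) * g a.
Proof.
elim: R => [|R IH]; first by rewrite big_ord0 ltn0.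
rewrite big_ord_recr /= IH ltnS; case: (ltngtP a R) => [||->]; rewrite ?mul0n ?mul1n ?addn0 ?add0n //.
Qed.

Lemma sum2_cells (R S : nat) (P : nat -> nat -> bool) f :
  sum2 R S (fun i j => P i j * extend f i j) =
  \sum_(x : cell la | [&& crow x < R, ccol x < S & P (crow x) (ccol x)]) f x.
Proof.
transitivity (\sum_(i < R) \sum_(j < S) \sum_(x : cell la)
    (crow x == i) * ((ccol x == j) * (P i j * f x))).
  apply: eq_bigr => i _; apply: eq_bigr => j _; rewrite /extend big_distrr /= big_mkcond.
  by apply: eq_bigr => x _; case: (crow x == i); case: (ccol x == j); rewrite ?mul1n ?mul0n.
under eq_bigr => i _ do rewrite exchange_big.
rewrite exchange_big [RHS]big_mkcond; apply: eq_bigr => x _ /=.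
under eq_bigr => i _ do rewrite -big_distrr (sum_delta S (ccol x) (fun j => P i j * f x)).
rewrite (sum_delta R (crow x) (fun i => (ccol x < S) * (P i (ccol x) * f x))).
by case: (_ < R); case: (_ < S); case: (P _ _); rewrite ?mul1n ?mul0n.
Qed.

Lemma rowlab_lt i i' : i < i' -> i' < p -> rowlab la i < rowlab la i'.
Proof.
move=> lt ltp; rewrite /rowlab; have := part_anti (ltnW lt).
by have [_ _ /(_ i)] := part_shape; lia.
Qed.

Lemma collab_lt j j' : j < j' -> j' < q -> collab la j' < collab la j.
Proof.
clear hla.
move=> lt ltq; rewrite /collab.
suff : count (fun m => j' < m) la <= count (fun m => j < m) la by lia.
by apply: sub_count => m /(ltn_trans lt).
Qed.

Lemma lab_cell i j k : i < p -> j < q -> rowlab la i <= k < collab la j -> j < l i.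
Proof.
move=> hi hj; rewrite /rowlab /collab => h; rewrite ltnNge; apply/negP => le.
have le' : count (fun m => j < m) la <= i by rewrite leqNgt conj_partP -leqNgt.
by have [_ _ /(_ i)] := part_shape; lia.
Qed.

(** With [diag_cols]: the boxes [[l, r]] with [l <= diag x < r] fill the rectangle whose lower right
    box is the last one on the diagonal of [x]. *)
Lemma diag_rows (x : cell la) (e := depth p l (crow x) (ccol x)) i :
  i < p -> (rowlab la i <= diag x) = (i < (crow x + e).+1).
Proof.
move=> hi; have [d1 d2] := depth_spec part_shape (cell_lt x); rewrite -/e in d1 d2.
have [_ _ lq] := part_shape; rewrite /rowlab /diag.
have := shape_col part_shape (cell_lt x) => cq.
have [lt|ge] := ltnP i (crow x + e).+1.
  have := part_anti (lt : i <= crow x + e); have := lq i; lia.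
by have := part_anti ge; have := lq i; lia.
Qed.

Lemma diag_cols (x : cell la) (e := depth p l (crow x) (ccol x)) j :
  j < q -> (diag x < collab la j) = (j < (ccol x + e).+1).
Proof.
move=> hj; have [d1 d2] := depth_spec part_shape (cell_lt x); rewrite -/e in d1 d2.
rewrite /collab /diag; have := shape_col part_shape (cell_lt x) => cq.
have mono a b : a <= b -> count (fun m => b < m) la <= count (fun m => a < m) la.
  by move=> le; apply: sub_count => m /(leq_ltn_trans le).
have [lt|ge] := ltnP j (ccol x + e).+1.
  by have := mono j (ccol x + e) lt; move: d1; rewrite -conj_partP; lia.
have := mono _ _ ge; suff : count (fun m => (ccol x + e).+1 < m) la <= (crow x + e).+1 by lia.
by rewrite leqNgt conj_partP -leqNgt.
Qed.

(** Along a diagonal [minij] grows by one per box, so [delta_k] is attained at the last box, [e]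
    steps below [x]. *)
Lemma dcoordE (x : cell la) : dcoord x = (depth p l (crow x) (ccol x)).+1.
Proof.
set e := depth _ _ _ _; have [d1 d2] := depth_spec part_shape (cell_lt x); rewrite -/e in d1 d2.
suff E : delta_k la (diag x) = minn (crow x + e).+1 (ccol x + e).+1.
  by rewrite /dcoord E /minij; lia.
have cx := shape_col part_shape (cell_lt x).
apply/eqP; rewrite eqn_leq; apply/andP; split.
  apply/bigmax_leqP => y /eqP; rewrite /diag /minij => dy.
  have cy := shape_col part_shape (cell_lt y); rewrite leqNgt; apply/negP => lt.
  have := shape_lt part_shape (cell_lt y) (_ : (crow x + e).+1 <= crow y); lia.
have [y [y1 y2]] := cell_ex d1.
have -> : minn (crow x + e).+1 (ccol x + e).+1 = minij y by rewrite /minij y1 y2.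
by apply: leq_bigmax_cond; rewrite /diag y1 y2; apply/eqP; lia.
Qed.

End Partition.

(** * Greene-Kleitman sums as maxima over chains of boxes *)

Lemma mem_bigcup_seqs (V : finType) (ps : seq (seq V)) (v : V) :
  (v \in \bigcup_(s <- ps) [set x in s]) = has (fun s => v \in s) ps.
Proof.
elim: ps => [|s ps IH]; first by rewrite big_nil inE.
by rewrite big_cons !inE IH.
Qed.

Section Link.

Variables (n : nat) (la : seq nat) (c : 'S_(n.+1)).
Hypotheses (n1 : 1 <= n) (hla : is_partition la) (hn : head 0 la + size la - 1 = n).
Hypothesis cox : coxeter c.

Local Notation l := (nth 0 la).
Local Notation p := (size la).
Local Notation q := (head 0 la).

Lemma rowlab_range i : i < p -> 0 < rowlab la i <= n.
Proof.
move=> lt; have := part_gt0 hla lt; have [_ _ /(_ i)] := part_shape hla.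
by rewrite /rowlab; lia.
Qed.

Lemma collab_range j : j < q -> 0 < collab la j <= n.+1.
Proof.
clear n1 hla cox.
by move=> lt; have := count_size (fun m => j < m) la; rewrite /collab; lia. Qed.

Definition vert (x : cell la) : ARvert n := (inord (rowlab la (crow x)), inord (collab la (ccol x))).

Lemma vrow_vert x : vrow (vert x) = rowlab la (crow x).
Proof.
have := rowlab_range (shape_row (part_shape hla) (cell_lt x)) => h.
by apply: inordK; lia.
Qed.

Lemma vcol_vert x : vcol (vert x) = collab la (ccol x).
Proof.
have := collab_range (shape_col (part_shape hla) (cell_lt x)) => h.
by apply: inordK; lia.
Qed.

Lemma vert_cell_inj : injective vert.
Proof.
move=> x y e; have e1 := congr1 (@vrow n) e; have e2 := congr1 (@vcol n) e.
rewrite !vrow_vert in e1; rewrite !vcol_vert in e2.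
have rx := shape_row (part_shape hla) (cell_lt x); have cx := shape_col (part_shape hla) (cell_lt x).
have ry := shape_row (part_shape hla) (cell_lt y); have cy := shape_col (part_shape hla) (cell_lt y).
apply: cell_inj.
  have [lt|lt|//] := ltngtP (crow x) (crow y).
    by have := rowlab_lt hla lt ry; lia.
  by have := rowlab_lt hla lt rx; lia.
have [lt|lt|//] := ltngtP (ccol x) (ccol y).
  by have := collab_lt lt cy; lia.
by have := collab_lt lt cx; lia.
Qed.

Lemma repE (f : {ffun cell la -> nat}) (v : ARvert n) :
  rep f v = \sum_(x | vert x == v) f x.
Proof.
rewrite /rep; case: pickP => [x /andP[/eqP e1 /eqP e2]|no].
  have ev : vert x = v by apply: vert_inj; rewrite ?vrow_vert ?vcol_vert.
  by rewrite (big_pred1 x) // => y; rewrite -ev (inj_eq vert_cell_inj).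
rewrite big_pred0 // => x; apply/eqP => ev; have /andP[] := negbT (no x).
by rewrite -ev -[nat_of_ord (vert x).1]/(vrow (vert x)) -[nat_of_ord (vert x).2]/(vcol (vert x)) vrow_vert vcol_vert !eqxx.
Qed.

Lemma sum_rep (f : {ffun cell la -> nat}) (A : {set ARvert n}) :
  \sum_(v in A) rep f v = \sum_(x | vert x \in A) f x.
Proof.
rewrite (partition_big vert (mem A)) //; apply: eq_bigr => v vA.
rewrite repE; apply: eq_bigl => x.
by case: eqP => [->|]; rewrite ?andbT ?andbF.
Qed.

Definition row_of (i : nat) : nat := row_pos c (rowlab la i).
Definition col_of (j : nat) : nat := col_pos c (collab la j).

(** Vertices without a box weigh 0. The boxes on a path form a chain, and a chain of boxes lies on a
    path, which may collect further boxes but never less weight. *)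
Lemma GK_M_gmax (f : {ffun cell la -> nat}) (k R S t : nat) :
  0 < k <= n -> R <= p -> S <= q ->
  (forall i, i < p -> (rowlab la i <= k) = (i < R)) ->
  (forall j, j < q -> (k < collab la j) = (j < S)) ->
  GK_M (AR_arrow c) (AR_k n k) (@rep la n f) t = gmax row_of col_of R S (extend f) t.
Proof.
move=> hk Rp Sq hR hS.
have inA x : (vert x \in AR_k n k) = (crow x < R) && (ccol x < S).
  have rx := shape_row (part_shape hla) (cell_lt x); have cx := shape_col (part_shape hla) (cell_lt x).
  rewrite -(hR _ rx) -(hS _ cx); apply/idP/idP => [/AR_kP|h].
    by rewrite vrow_vert vcol_vert; lia.
  apply/AR_kP; rewrite vrow_vert vcol_vert.
  by have := rowlab_range rx; have := collab_range cx; lia.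
have cell_in i j : i < R -> j < S -> exists x : cell la, crow x = i /\ ccol x = j.
  move=> hi hj; apply: (cell_ex hla); apply: (lab_cell hla (k := k)).
  - exact: leq_trans Rp.
  - exact: leq_trans Sq.
  by rewrite hR ?hS ?hi ?hj // ?(leq_trans hi) ?(leq_trans hj).
have posE x y : box_comparable row_of col_of (crow x) (ccol x) (crow y) (ccol y)
    = vle c (vert x) (vert y) || vle c (vert y) (vert x).
  by rewrite /box_comparable /vle !vrow_vert !vcol_vert.
apply/eqP; rewrite eqn_leq; apply/andP; split.
  apply/bigmax_leqP => A /asboolP[ps [sz al eA]].
  apply: gmax_ge.
  exists (fun m i j => [exists x : cell la, [&& crow x == i, ccol x == j & vert x \in nth [::] ps m]]).
  split=> [m ltm i j i' j' _ _ _ _ /existsP[x /and3P[/eqP<- /eqP<- hx]] /existsP[y /and3P[/eqP<- /eqP<- hy]]|].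
    rewrite posE; apply: (gpath_vle cox hk) hx hy.
    by apply: (allP al); rewrite mem_nth ?sz.
  rewrite sum_rep sum2_cells big_mkcond [leqRHS]big_mkcond /=; apply: leq_sum => x _.
  case: ifP => // xA; suff -> : [&& crow x < R, ccol x < S & covered t (fun m i j =>
      [exists x : cell la, [&& crow x == i, ccol x == j & vert x \in nth [::] ps m]]) (crow x) (ccol x)] by [].
  move: xA; rewrite eA mem_bigcup_seqs => /hasP[pa pas xpa].
  have xk : vert x \in AR_k n k.
    have := allP al pa pas; case: pa xpa {pas} => // y s xpa /andP[_ /allP]; exact.
  rewrite inA in xk; have /andP[-> ->] := xk; apply/hasP; exists (index pa ps).
    by rewrite mem_iota -sz index_mem.
  by apply/existsP; exists x; rewrite !eqxx nth_index.
have [C [hC le]] := gmax_achieves row_of col_of R S (extend f) t.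
apply: leq_trans le _.
pose D m := [set vert x | x : cell la & [&& crow x < R, ccol x < S & C m (crow x) (ccol x)]].
have ex m : exists pa, m < t -> is_gpath (AR_arrow c) (AR_k n k) pa /\ {subset D m <= pa}.
  case: (ltnP m t) => [lt|_]; last by exists [::].
  have [||pa h1 h2] := @chain_gpath_AR n k c cox hk (D m); last by exists pa.
  - by apply/subsetP => v /imsetP[x]; rewrite inE => /and3P[h1 h2 _] ->; rewrite inA h1.
  - move=> v w /imsetP[x] + -> /imsetP[y] + ->; rewrite !inE => /and3P[h1 h2 h3] /and3P[h4 h5 h6].
    by rewrite -posE; apply: (hC m lt).
pose pa m := projT1 (cid (ex m)).
have paP m : m < t -> is_gpath (AR_arrow c) (AR_k n k) (pa m) /\ {subset D m <= pa m}.
  exact: (projT2 (cid (ex m))).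
pose ps := [seq pa m | m <- iota 0 t].
pose A := \bigcup_(w <- ps) [set x in w].
have hA : `[< exists ps : seq (seq (ARvert n)),
    [/\ size ps = t, all (is_gpath (AR_arrow c) (AR_k n k)) ps & A = \bigcup_(w <- ps) [set x in w]] >].
  apply/asboolP; exists ps; split=> //; first by rewrite size_map size_iota.
  by apply/allP => w /mapP[m]; rewrite mem_iota => /andP[_ lt] ->; have [] := paP m lt.
apply: leq_trans (leq_bigmax_cond _ hA).
rewrite sum_rep sum2_cells big_mkcond [leqRHS]big_mkcond /=; apply: leq_sum => x _.
case: ifP => // /and3P[h1 h2 /hasP[m]]; rewrite mem_iota => /andP[_ lt] cx.
suff -> : vert x \in A by [].
rewrite mem_bigcup_seqs; apply/hasP; exists (pa m); first by apply: map_f; rewrite mem_iota.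
have [_] := paP m lt; apply; apply: imset_f.
by rewrite inE h1 h2.
Qed.

End Link.

(** * Local rules for the parts of the invariants, and the bijection *)

Definition gpart (pr pc : nat -> nat) (F : nat -> nat -> nat) (r s d : nat) : nat :=
  gmax pr pc r s F d.+1 - gmax pr pc r s F d.

Lemma psum_gpart pr pc F r s t : psum (gpart pr pc F r s) t = gmax pr pc r s F t.
Proof.
elim: t => [|t IH]; first by rewrite psum0 gmax0.
by rewrite psumS IH /gpart subnKC // gmax_mono.
Qed.

Lemma gpart_fin pr pc F r s d : minn r s <= d -> gpart pr pc F r s d = 0.
Proof. by move=> le; rewrite /gpart !gmax_total ?subnn // ltnW. Qed.

Lemma gpart_local pr pc F F' r s d :
  (forall i j, i < r -> j < s -> F i j = F' i j) -> gpart pr pc F r s d = gpart pr pc F' r s d.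
Proof. by move=> e; rewrite /gpart !(eq_gmax_fill _ _ _ e). Qed.

(** Subtracting the identities at consecutive [k] cancels the corner entry; the minimum arises as
    the sum of two parts less their maximum. *)
Lemma gpart_rule_same pr pc F r s :
  (forall k, gmax pr pc r.+1 s.+1 F k.+1 + gmax pr pc r s F k =
    F r s + maxn (gmax pr pc r.+1 s F k.+1 + gmax pr pc r s.+1 F k)
                 (gmax pr pc r.+1 s F k + gmax pr pc r s.+1 F k.+1)) ->
  local_rule true (gpart pr pc F r s) (F r s) (gpart pr pc F r.+1 s)
    (gpart pr pc F r s.+1) (gpart pr pc F r.+1 s.+1).
Proof.
move=> R; split=> [|d].
  by have := R 0; rewrite -!psum_gpart !psumS !psum0; lia.
by have := R d.+1; have := R d; rewrite -!psum_gpart !psumS; lia.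
Qed.

Lemma gpart_rule_opp pr pc F r s :
  (forall k, gmax pr pc r.+1 s.+1 F k.+1 + gmax pr pc r s F k.+1 =
    maxn (gmax pr pc r.+1 s F k.+1 + gmax pr pc r s.+1 F k.+1)
         (gmax pr pc r.+1 s.+1 F k.+2 + gmax pr pc r s F k)) ->
  local_rule false (gpart pr pc F r s) (F r s) (gpart pr pc F r.+1 s)
    (gpart pr pc F r s.+1) (gpart pr pc F r.+1 s.+1).
Proof.
move=> R; split=> [k|]; first by rewrite !psum_gpart R.
(* From [r.+1] chains on all four totals are reached, and inclusion-exclusion over the rectangles
   isolates the corner entry. *)
exists r.+1 => k lek; rewrite !psum_gpart !gmax_total; try lia.
have E s' : sum2 r.+1 s' F = sum2 r s' F + \sum_(j < s') F r j by rewrite /sum2 big_ord_recr.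
by rewrite !E big_ord_recr /=; lia.
Qed.

Section Main.

Variables (n : nat) (la : seq nat) (c : 'S_(n.+1)).
Hypotheses (n1 : 1 <= n) (hla : is_partition la) (hn : head 0 la + size la - 1 = n).
Hypothesis cox : coxeter c.

Local Notation l := (nth 0 la).
Local Notation p := (size la).
Local Notation q := (head 0 la).
Local Notation pr := (row_of la c).
Local Notation pc := (col_of la c).

(* The new row is last iff its label is an ascent, the new column is last iff
   its label is a descent. *)
Definition corner_type (r s : nat) : bool := ascent c (rowlab la r) (+) ascent c (collab la s).

Lemma gpart_rule F r s : r < p -> s < q ->
  local_rule (corner_type r s) (gpart pr pc F r s) (F r s) (gpart pr pc F r.+1 s)
    (gpart pr pc F r s.+1) (gpart pr pc F r.+1 s.+1).
Proof.
move=> hr hs; pose M := 3 * n.+1.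
have prM i : i < r.+1 -> pr i <= M.
  move=> hi; have := rowlab_range n1 hla hn (leq_trans hi hr).
  by rewrite /row_of /row_pos /M; case: ifP => _; lia.
have pcM j : j < s.+1 -> pc j <= M.
  move=> hj; have := collab_range hn (leq_trans hj hs).
  by rewrite /col_of /col_pos /M; case: ifP => _; lia.
have prE i : i < r -> if ascent c (rowlab la r) then pr i < pr r else pr r < pr i.
  move=> hi; have lt := rowlab_lt hla hi hr.
  have := rowlab_range n1 hla hn hr; have := rowlab_range n1 hla hn (ltn_trans hi hr).
  by rewrite /row_of /row_pos; case: (ascent c (rowlab la r)); case: (ascent c (rowlab la i)); lia.
have pcE j : j < s -> if ascent c (collab la s) then pc s < pc j else pc j < pc s.
  move=> hj; have lt := collab_lt hj hs.
  have := collab_range hn hs; have := collab_range hn (ltn_trans hj hs).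
  by rewrite /col_of /col_pos; case: (ascent c (collab la s)); case: (ascent c (collab la j)); lia.
have rev r' s' t : r' <= r.+1 -> s' <= s.+1 -> gmax pr pc r' s' F t =
    gmax (fun i => M - pr i) (fun j => M - pc j) r' s' F t.
  by move=> h1 h2; apply: gmax_rev => [i hi|j hj]; [apply/prM/(leq_trans hi)|apply/pcM/(leq_trans hj)].
(* The new row is last in the first two cases, where the identities apply directly. In the other two
   it is first, and a half turn makes it last. *)
rewrite /corner_type; case: (ascent c (rowlab la r)) prE; case: (ascent c (collab la s)) pcE => pcE prE /=.
- by apply: gpart_rule_opp => k; apply: gmax_opp_corner.
- by apply: gpart_rule_same => k; apply: gmax_same_corner.
- apply: gpart_rule_same => k; rewrite !rev //; apply: gmax_same_corner => [i hi|j hj].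
    by have := prE i hi; have := prM i (ltnW hi); lia.
  by have := pcE j hj; have := pcM j (ltnW hj); lia.
- apply: gpart_rule_opp => k; rewrite !rev //; apply: gmax_opp_corner => [i hi|j hj].
    by have := prE i hi; have := prM i (ltnW hi); lia.
  by have := pcE j hj; have := pcM s (ltnSn s); lia.
Qed.

Lemma RSK_growth (f : {ffun cell la -> nat}) (x : cell la) :
  RSK c f x = growth_map p (gpart pr pc) (extend f) l (crow x) (ccol x).
Proof.
have sh := part_shape hla; have lx := cell_lt x.
have [d1 d2] := depth_spec sh lx.
have Rp := shape_row sh d1; have Sq := shape_col sh d1.
have rx := shape_row sh lx; have cx := shape_col sh lx.
rewrite ffunE /GK_part dcoordE //= /growth_map /gpart.
by rewrite !(@GK_M_gmax n la c n1 hla hn cox f (diag x) _ _ _ _ Rp Sq (@diag_rows la hla x) (@diag_cols la hla x)) //;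
  rewrite /diag; lia.
Qed.

Lemma increasing_mono g i j i' j' : increasing l g ->
  i <= i' -> j <= j' -> j' < l i' -> g i j <= g i' j'.
Proof.
move=> gi lei lej lt; have sh := part_shape hla.
have lt2 := shape_lt sh lt lei.
have row : g i j <= g i j'.
  move: lt2; rewrite -(subnKC lej); elim: (j' - j) => [|d IH]; first by rewrite addn0.
  by rewrite addnS => lt2; apply: leq_trans (IH (ltnW lt2)) _; have [+ _] := gi i (j + d); apply.
apply: leq_trans row _; move: lt; rewrite -(subnKC lei).
elim: (i' - i) => [|d IH]; first by rewrite addn0.
rewrite addnS => lt3; have [_ /(_ lt3)] := gi (i + d) j'; apply: leq_trans; apply: IH.
by apply: (shape_lt sh lt3).
Qed.

End Main.

Theorem theorem6p1 (n : nat) (la : seq nat) (c : 'S_(n.+1)) :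
  1 <= n -> is_partition la -> head 0 la + size la - 1 = n -> coxeter c ->
  [/\ (forall f : {ffun cell la -> nat}, is_rpp (RSK c f)),
      injective (@RSK n c la)
    & (forall g : {ffun cell la -> nat}, is_rpp g -> exists f, RSK c f = g)].
Proof.
move=> n1 hla hn cox; have sh := part_shape hla.
have loc F F' r s d := @gpart_local (row_of la c) (col_of la c) F F' r s d.
have fin F r s d := @gpart_fin (row_of la c) (col_of la c) F r s d.
have rule F r s := @gpart_rule n la c n1 hla hn F r s.
have [inj sur] := bijective_on_shape fin loc rule sh.
have RE := RSK_growth n1 hla hn cox.
split.
- move=> f x y le1 le2; rewrite !RE; apply: (increasing_mono hla _ le1 le2 (cell_lt y)).
  exact: (growth_map_increasing fin rule (extend f) sh).
- move=> f f' e; apply/ffunP => x; rewrite -!extendE; apply: inj (cell_lt x) => i j lt.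
  by have [y [<- <-]] := cell_ex hla lt; rewrite -!RE e.
move=> g gi; have [|F FP] := sur (extend g).
  move=> i j; split=> lt.
    have [y [y1 y2]] := cell_ex hla lt; have [x [x1 x2]] := cell_ex hla (ltnW lt).
    by rewrite -{1}x1 -{1}x2 -y1 -y2 !extendE; apply: gi; rewrite ?x1 ?x2 ?y1 ?y2.
  have [y [y1 y2]] := cell_ex hla lt; have [x [x1 x2]] := cell_ex hla (shape_lt sh lt (leqnSn i)).
  by rewrite -{1}x1 -{1}x2 -y1 -y2 !extendE; apply: gi; rewrite ?x1 ?x2 ?y1 ?y2.
exists [ffun x => F (crow x) (ccol x)]; apply/ffunP => x; rewrite RE -(extendE g x).
(* The rectangle in which the entry of [x] is computed lies inside the diagram, so restricting [F]
   to the boxes does not change it. *)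
rewrite -FP ?cell_lt //; apply: loc => i j hi hj.
have [d1 _] := depth_spec sh (cell_lt x).
have lt : j < nth 0 la i.
  by apply: leq_trans (shape_lt sh d1 _).
have [y [<- <-]] := cell_ex hla lt.
by rewrite extendE // ffunE.
Qed.
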